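(* Let $k$ be a positive integer, let $A$ be a finitely generated free nilpotent group of class $k$, and let $F$ be an $A$-free group. Let $n$ be a positive integer and let $Y\subseteq F^n$ be an irreducible algebraic set. Then the coordinate group $\Gamma(Y)$ is a $\mathrm{CSN}_k$ group.
   Context: Conventions: $H^x=x^{-1}Hx$. Simple commutators $[x_1,x_2,\ldots,x_{k+1}]$ are left-normed (left aligned). For a positive integer $k$, a group is called nilpotent of class $k$ if the identity $[x_1,x_2,\ldots,x_{k+1}]=1$ holds in it (so the class is at most $k$ in the usual terminology). A free nilpotent group of class $k$ is a free object in the variety of class $k$ nilpotent groups. A group $F$ is $A$-free if it is the free product of a set of copies of $A$. A subgroup $H$ of a group $G$ is malnormal if $H\cap H^x=1$ for every $x\in G\setminus H$. A group $G$ is $\mathrm{CSN}_k$ (conjugately separated nilpotent of class $k$) if every maximal element (with respect to inclusion) of the set of class $k$ nilpotent subgroups of $G$ is malnormal in $G$. Let $X=\{x_1,\ldots,x_n\}$ and let $F[X]=F\ast\mathbb{F}[X]$ be the free product of $F$ with the free group $\mathbb{F}[X]$ on $X$; its elements are group words $w(x_1,\ldots,x_n)$ in the variables with coefficients from $F$. For $S\subseteq F[X]$, put $V_F(S)=\{(f_1,\ldots,f_n)\in F^n : w(f_1,\ldots,f_n)=1 \text{ for all } w\in S\}$. Subsets of $F^n$ of this form are called algebraic sets. The Zariski topology on $F^n$ is the topology having the algebraic sets as a subbasis of closed sets (closed sets are arbitrary intersections of finite unions of algebraic sets). An algebraic set is irreducible if it is irreducible in this topology, i.e. it is nonempty and is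 not the union of two proper closed subsets. For $Y\subseteq F^n$, the radical of $Y$ is the normal subgroup $\mathrm{Rad}(Y)=\{w\in F[X] : w(y)=1 \text{ for all } y\in Y\}$ of $F[X]$, and the coordinate group of $Y$ is $\Gamma(Y)=F[X]/\mathrm{Rad}(Y)$. *)

(* Defs.v *)
From HB Require Import structures.
From mathcomp Require Import all_boot.
From mathcomp Require Import boolp classical_sets.

Set Implicit Arguments.
Unset Strict Implicit.
Unset Printing Implicit Defensive.

Local Open Scope classical_set_scope.
Local Open Scope group_scope.
Local Open Scope quotient_scope.

(* Groups are MathComp's (possibly infinite) [groupType], homomorphisms are
   [hom G H], subsets are [set G].  The library conventions
   [x ^ y = y^-1 * x * y] and [[~ x, y] = x^-1 * y^-1 * x * y] are used. *)

Notation hom := UMagmaMorphism.type.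

Lemma morph_one (G H : groupType) (f : G -> H) :
  {morph f : x y / x * y} -> f 1 = 1.
Proof. by move=> fM; apply: (mulgI (f 1)); rewrite -fM !mulg1. Qed.

Section Subgroups.
Variable G : groupType.
Implicit Types (H K : set G) (k : nat).

Definition is_subgroup H : Prop :=
  [/\ H 1, (forall x y, H x -> H y -> H (x * y))
         & (forall x, H x -> H x^-1)].

Definition is_normal_subgroup H : Prop :=
  is_subgroup H /\ (forall x y, H x -> H (x ^ y)).

Definition conj_set H (x : G) : set G := [set h ^ x | h in H].

Definition malnormal H : Prop :=
  forall x, ~ H x -> H `&` conj_set H x = [set 1].

Definition left_normed_comm (x : G) (s : seq G) : G :=
  foldl (fun a b => [~ a, b]) x s.

(* The identity [x_1, ..., x_{k+1}] = 1 on H: class at most k. *)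
Definition nilpotent_on k H : Prop :=
  forall (x : G) (s : seq G), size s = k -> H x -> (forall y, y \in s -> H y) ->
    left_normed_comm x s = 1.

Definition nilpotent_subgroup k H : Prop := is_subgroup H /\ nilpotent_on k H.

Definition maximal_nilpotent_subgroup k H : Prop :=
  nilpotent_subgroup k H /\
  forall K, nilpotent_subgroup k K -> H `<=` K -> K = H.

Definition finitely_generated : Prop :=
  exists s : seq G, forall H, is_subgroup H -> (forall x, x \in s -> H x) ->
    H = [set: G].

End Subgroups.

Definition nilpotent_group (k : nat) (G : groupType) : Prop :=
  nilpotent_on k [set: G].

Definition CSN (k : nat) (G : groupType) : Prop :=
  forall H : set G, maximal_nilpotent_subgroup k H -> malnormal H.

Definition isomorphic (G H : groupType) : Prop :=
  exists f : hom G H, bijective f.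

Definition is_free_nilpotent_on (k : nat) (A : groupType) (B : Type)
    (b : B -> A) : Prop :=
  nilpotent_group k A /\
  forall H : groupType, nilpotent_group k H -> forall f : B -> H,
    (exists phi : hom A H, forall i, phi (b i) = f i) /\
    (forall phi psi : hom A H,
       (forall i, phi (b i) = f i) -> (forall i, psi (b i) = f i) ->
       phi =1 psi).

Definition free_nilpotent (k : nat) (A : groupType) : Prop :=
  exists (B : Type) (b : B -> A), is_free_nilpotent_on k b.

Record normalSubgroup (G : groupType) := NormalSubgroup {
  nsub_set : G -> Prop;
  nsubP : is_normal_subgroup nsub_set
}.
Coercion nsub_set : normalSubgroup >-> Funclass.

Section Quotient.
Variables (G : groupType) (N : normalSubgroup G).

Definition quo_rel : rel G := fun x y => `[< N (x^-1 * y) >].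

Lemma quo_rel_equiv : equiv_class_of quo_rel.
Proof.
have [[N1 NM NV] _] := nsubP N.
split=> [x|x y|y x z]; rewrite /quo_rel.
- by apply/asboolP; rewrite mulVg.
- by apply/asboolP/asboolP=> /NV; rewrite invgM invgK.
- move=> /asboolP h1 /asboolP h2; apply/asboolP.
  by have := NM _ _ h1 h2; rewrite mulgA mulgK.
Qed.

Canonical quo_equiv := EquivRelPack quo_rel_equiv.

Definition quo := {eq_quot quo_equiv}.
HB.instance Definition _ := Choice.on quo.
HB.instance Definition _ := EqQuotient.on quo.

Definition quo_proj (x : G) : quo := \pi_quo x.

Lemma quoW (P : quo -> Prop) : (forall x, P (quo_proj x)) -> forall a, P a.
Proof. by move=> h; elim/quotW=> x; apply: h. Qed.

Lemma quo_eqP (x y : G) : quo_proj x = quo_proj y <-> N (x^-1 * y).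
Proof.
rewrite /quo_proj; split; first by move=> /eqquotP /asboolP.
by move=> h; apply/eqquotP/asboolP.
Qed.

Definition quo_mul (a b : quo) : quo := quo_proj (repr a * repr b).
Definition quo_one : quo := quo_proj 1.
Definition quo_inv (a : quo) : quo := quo_proj (repr a)^-1.

Lemma quo_piM (x y : G) : quo_mul (quo_proj x) (quo_proj y) = quo_proj (x * y).
Proof.
have [[N1 NM NV] NJ] := nsubP N.
have hx : N ((repr (quo_proj x))^-1 * x) by apply/quo_eqP; apply: reprK.
have hy : N ((repr (quo_proj y))^-1 * y) by apply/quo_eqP; apply: reprK.
apply/quo_eqP; set a := repr _ in hx *; set b := repr _ in hy *.
have -> : (a * b)^-1 * (x * y) = (a^-1 * x) ^ b * (b^-1 * y).
  by rewrite conjgE invgM !mulgA mulgK.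
by apply: NM => //; apply: NJ.
Qed.

Lemma quo_piV (x : G) : quo_inv (quo_proj x) = quo_proj x^-1.
Proof.
have [[N1 NM NV] NJ] := nsubP N.
have hx : N ((repr (quo_proj x))^-1 * x) by apply/quo_eqP; apply: reprK.
apply/quo_eqP; set a := repr _ in hx *.
by have := NJ _ a^-1 (NV _ hx); rewrite conjgE invgM !invgK !mulgA mulgK.
Qed.

Lemma quo_mulA : associative quo_mul.
Proof. by elim/quoW=> x; elim/quoW=> y; elim/quoW=> z; rewrite !quo_piM mulgA. Qed.
Lemma quo_mul1 : left_id quo_one quo_mul.
Proof. by elim/quoW=> x; rewrite quo_piM mul1g. Qed.
Lemma quo_1mul : right_id quo_one quo_mul.
Proof. by elim/quoW=> x; rewrite quo_piM mulg1. Qed.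
Lemma quo_mulV : left_inverse quo_one quo_inv quo_mul.
Proof. by elim/quoW=> x; rewrite quo_piV quo_piM mulVg. Qed.
Lemma quo_Vmul : right_inverse quo_one quo_inv quo_mul.
Proof. by elim/quoW=> x; rewrite quo_piV quo_piM mulgV. Qed.

HB.instance Definition _ :=
  isGroup.Build quo quo_mulA quo_mul1 quo_1mul quo_mulV quo_Vmul.

Lemma quo_projM : {morph quo_proj : x y / x * y}.
Proof. by move=> x y; rewrite -[LHS]quo_piM. Qed.
HB.instance Definition _ :=
  isMultiplicative.Build G quo quo_proj quo_projM.
HB.instance Definition _ :=
  Multiplicative_isUMagmaMorphism.Build G quo quo_proj (morph_one quo_projM).

Lemma quo_proj_surj (a : quo) : exists x, quo_proj x = a.
Proof. by exists (repr a); apply: reprK. Qed.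

Lemma quo_proj_ker (x : G) : quo_proj x = 1 <-> N x.
Proof.
have [[N1 NM NV] _] := nsubP N.
have -> : 1 = quo_proj 1 by [].
rewrite quo_eqP mulg1.
by split=> /NV; rewrite ?invgK.
Qed.

Section Lift.
Variables (H : groupType) (f : hom G H).
Hypothesis fN : forall x, N x -> f x = 1.

Definition quo_lift_fun of (forall x, N x -> f x = 1) :=
  fun a : quo => f (repr a).

Lemma quo_lift_funE (x : G) : quo_lift_fun fN (quo_proj x) = f x.
Proof.
rewrite /quo_lift_fun.
have : N ((repr (quo_proj x))^-1 * x) by apply/quo_eqP; apply: reprK.
move=> /fN; rewrite gmulfM gmulfV => h.
by apply: (mulgI (f (repr (quo_proj x)))^-1); rewrite mulVg h.
Qed.

Lemma quo_lift_funM : {morph quo_lift_fun fN : a b / a * b}.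
Proof.
move=> a b; have [x <-] := quo_proj_surj a; have [y <-] := quo_proj_surj b.
by rewrite -quo_projM !quo_lift_funE gmulfM.
Qed.
HB.instance Definition _ :=
  isMultiplicative.Build quo H (quo_lift_fun fN) quo_lift_funM.
HB.instance Definition _ :=
  Multiplicative_isUMagmaMorphism.Build quo H (quo_lift_fun fN) (morph_one quo_lift_funM).

Definition quo_lift : hom quo H := quo_lift_fun fN.

Lemma quo_liftE (x : G) : quo_lift (quo_proj x) = f x.
Proof. exact: quo_lift_funE. Qed.
End Lift.

End Quotient.

Section NormalClosure.
Variables (G : groupType) (R : set G).

Definition ncl_set : set G :=
  [set x | forall N : normalSubgroup G, (forall r, R r -> N r) -> N x].

Lemma ncl_normal : is_normal_subgroup ncl_set.
Proof.
split; first split.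
- by move=> N _; have [[]] := nsubP N.
- move=> x y hx hy N RN; have [[_ NM _] _] := nsubP N.
  by apply: NM; [apply: hx | apply: hy].
- move=> x hx N RN; have [[_ _ NV] _] := nsubP N.
  by apply: NV; apply: hx.
- move=> x y hx N RN; have [_ NJ] := nsubP N.
  by apply: NJ; apply: hx.
Qed.

Definition normal_closure : normalSubgroup G := NormalSubgroup ncl_normal.
End NormalClosure.

Section Kernel.
Variables (G H : groupType) (f : hom G H).

Lemma ker_normal : is_normal_subgroup [set x | f x = 1].
Proof.
split; first split=> /= [|x y hx hy|x hx].
- exact: gmulf1.
- by rewrite gmulfM hx hy mulg1.
- by rewrite gmulfV hx invg1.
- by move=> x y /= hx; rewrite conjgE !gmulfM hx mul1g gmulfV mulVg.
Qed.

Definition kernel : normalSubgroup G := NormalSubgroup ker_normal.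
End Kernel.

(* The letter (x, false) stands for x and (x, true) for x^-1. *)
Definition fword (X : Type) := {classic seq (X * bool)}.

Inductive fword_eq (X : Type) : fword X -> fword X -> Prop :=
| fword_refl u : fword_eq u u
| fword_sym u v : fword_eq u v -> fword_eq v u
| fword_trans u v w : fword_eq u v -> fword_eq v w -> fword_eq u w
| fword_cancel (u v : seq (X * bool)) x b :
    fword_eq (u ++ [:: (x, b); (x, ~~ b)] ++ v) (u ++ v).

Section FreeGroup.
Variable X : Type.
Implicit Types u v w : seq (X * bool).

Definition fword_rel : rel (fword X) := fun u v => `[< fword_eq u v >].

Lemma fword_rel_equiv : equiv_class_of fword_rel.
Proof.
split=> [u|u v|v u w]; rewrite /fword_rel.
- by apply/asboolP; apply: fword_refl.
- by apply/asboolP/asboolP; apply: fword_sym.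
- by move=> /asboolP h1 /asboolP h2; apply/asboolP; apply: fword_trans h1 h2.
Qed.
Canonical fword_equiv := EquivRelPack fword_rel_equiv.

Definition free_group := {eq_quot fword_equiv}.
HB.instance Definition _ := Choice.on free_group.
HB.instance Definition _ := EqQuotient.on free_group.

Definition fclass (u : seq (X * bool)) : free_group := \pi_free_group (u : fword X).

Lemma fclassP u v : fclass u = fclass v <-> fword_eq u v.
Proof.
split; first by move=> /eqquotP /asboolP.
by move=> h; apply/eqquotP/asboolP.
Qed.

Lemma fclassW (P : free_group -> Prop) : (forall u, P (fclass u)) -> forall a, P a.
Proof. by move=> h; elim/quotW=> u; apply: h. Qed.

Lemma fclass_repr u : fword_eq (repr (fclass u)) u.
Proof. by apply/fclassP; rewrite /fclass reprK. Qed.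

Lemma fword_catl w u v : fword_eq u v -> fword_eq (w ++ u) (w ++ v).
Proof.
elim=> {u v} [u|u v _|u v t _ h1 _ h2|u v x b].
- exact: fword_refl.
- exact: fword_sym.
- exact: fword_trans h1 h2.
- by rewrite !(catA w); apply: fword_cancel.
Qed.

Lemma fword_catr w u v : fword_eq u v -> fword_eq (u ++ w) (v ++ w).
Proof.
elim=> {u v} [u|u v _|u v t _ h1 _ h2|u v x b].
- exact: fword_refl.
- exact: fword_sym.
- exact: fword_trans h1 h2.
- by rewrite -!catA; apply: fword_cancel.
Qed.

Definition fword_inv u : seq (X * bool) := rev [seq (t.1, ~~ t.2) | t <- u].

Lemma fword_mulV u : fword_eq (u ++ fword_inv u) [::].
Proof.
elim: u => [|[x b] u IH]; first exact: fword_refl.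
rewrite /fword_inv /= rev_cons -cats1 catA.
apply: (@fword_trans _ _ ([:: (x, b)] ++ [:: (x, ~~ b)])).
  by rewrite -cat_cons -cat1s; apply: fword_catr; rewrite -{2}[[:: _]]cats0;
     apply: fword_catl.
exact: (@fword_cancel X [::] [::]).
Qed.

Lemma fword_invK : involutive fword_inv.
Proof.
move=> u; rewrite /fword_inv map_rev revK -map_comp -[RHS]map_id.
by apply: eq_map => -[x b] /=; rewrite negbK.
Qed.

Lemma fword_Vmul u : fword_eq (fword_inv u ++ u) [::].
Proof. by rewrite -{2}[u]fword_invK; apply: fword_mulV. Qed.

Definition fg_mul (a b : free_group) : free_group := fclass (repr a ++ repr b).
Definition fg_one : free_group := fclass [::].
Definition fg_inv (a : free_group) : free_group := fclass (fword_inv (repr a)).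

Lemma fg_mulE u v : fg_mul (fclass u) (fclass v) = fclass (u ++ v).
Proof.
apply/fclassP; apply: (@fword_trans _ _ (u ++ repr (fclass v))).
  by apply: fword_catr; apply: fclass_repr.
by apply: fword_catl; apply: fclass_repr.
Qed.

Lemma fg_mulA : associative fg_mul.
Proof.
by elim/fclassW=> u; elim/fclassW=> v; elim/fclassW=> w; rewrite !fg_mulE catA.
Qed.
Lemma fg_mul1 : left_id fg_one fg_mul.
Proof. by elim/fclassW=> u; rewrite fg_mulE. Qed.
Lemma fg_1mul : right_id fg_one fg_mul.
Proof. by elim/fclassW=> u; rewrite fg_mulE cats0. Qed.
Lemma fg_mulV : left_inverse fg_one fg_inv fg_mul.
Proof.
move=> a; rewrite -{2}[a]reprK -/(fclass (repr a)) fg_mulE.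
by apply/fclassP; apply: fword_Vmul.
Qed.
Lemma fg_Vmul : right_inverse fg_one fg_inv fg_mul.
Proof.
move=> a; rewrite -{1}[a]reprK -/(fclass (repr a)) fg_mulE.
by apply/fclassP; apply: fword_mulV.
Qed.

HB.instance Definition _ :=
  isGroup.Build free_group fg_mulA fg_mul1 fg_1mul fg_mulV fg_Vmul.

Lemma fclassM u v : fclass (u ++ v) = fclass u * fclass v.
Proof. by rewrite -fg_mulE. Qed.

Definition free_gen (x : X) : free_group := fclass [:: (x, false)].

Lemma fclass_neg x : fclass [:: (x, true)] = (free_gen x)^-1.
Proof.
apply: (mulgI (free_gen x)); rewrite mulgV -fclassM.
by apply/fclassP; apply: (@fword_cancel X [::] [::]).
Qed.

Section Lift.
Variables (H : groupType) (f : X -> H).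

Definition fword_eval u : H := \prod_(t <- u) (if t.2 then (f t.1)^-1 else f t.1).

Lemma fword_eval_eq u v : fword_eq u v -> fword_eval u = fword_eval v.
Proof.
elim=> {u v} [//|u v _ //|u v w _ -> _ //|u v x b].
rewrite /fword_eval !big_cat /= !big_cons big_nil /= mulg1.
by case: b => /=; rewrite ?mulVg ?mulgV mul1g.
Qed.

Definition free_lift_fun (a : free_group) : H := fword_eval (repr a).

Lemma free_lift_fclass u : free_lift_fun (fclass u) = fword_eval u.
Proof. by apply: fword_eval_eq; apply: fclass_repr. Qed.

Lemma free_lift_funM : {morph free_lift_fun : a b / a * b}.
Proof.
elim/fclassW=> u; elim/fclassW=> v.
by rewrite -fclassM !free_lift_fclass /fword_eval big_cat.
Qed.
HB.instance Definition _ :=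
  isMultiplicative.Build free_group H free_lift_fun free_lift_funM.
HB.instance Definition _ :=
  Multiplicative_isUMagmaMorphism.Build free_group H free_lift_fun (morph_one free_lift_funM).

Definition free_lift : hom free_group H := free_lift_fun.

Lemma free_lift_gen x : free_lift (free_gen x) = f x.
Proof. by rewrite /= free_lift_fclass /fword_eval big_seq1. Qed.

Lemma free_lift_unique (phi psi : hom free_group H) :
  (forall x, phi (free_gen x) = psi (free_gen x)) -> phi =1 psi.
Proof.
move=> h; elim/fclassW; elim=> [|[x b] u IH].
  by rewrite (_ : fclass [::] = 1) // !gmulf1.
rewrite -cat1s fclassM !gmulfM IH; congr (_ * _).
by case: b; rewrite ?fclass_neg ?gmulfV h.
Qed.
End Lift.

End FreeGroup.

(* The free product of (G_i), as the free group on the disjoint union of the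
   G_i modulo the multiplication tables of the factors. *)
Section FreeProduct.
Variables (I : Type) (G : I -> groupType).

Definition fp_letter (i : I) (a : G i) : free_group {i : I & G i} :=
  free_gen (existT (fun i => Group.sort (G i)) i a).

Definition fp_relators : set (free_group {i : I & G i}) :=
  [set r | exists (i : I) (a b : G i),
     r = fp_letter a * fp_letter b * (fp_letter (a * b))^-1].

Definition free_prod : groupType := quo (normal_closure fp_relators).

Definition fp_in_fun (i : I) (a : G i) : free_prod :=
  quo_proj (normal_closure fp_relators) (fp_letter a).

Lemma fp_in_funM (i : I) : {morph @fp_in_fun i : a b / a * b}.
Proof.
move=> a b; rewrite /fp_in_fun -gmulfM; apply/esym/quo_eqP => N hN.
have [[_ NM NV] NJ] := nsubP N.
have /NV /(NJ _ (fp_letter a * fp_letter b)) : N (fp_letter a * fp_letter b *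
  (fp_letter (a * b))^-1) by apply: hN; exists i, a, b.
set L := fp_letter a * fp_letter b.
by rewrite conjgE (invgM L) invgK divgK.
Qed.
HB.instance Definition _ (i : I) :=
  isMultiplicative.Build (G i) free_prod (@fp_in_fun i) (@fp_in_funM i).
HB.instance Definition _ (i : I) :=
  Multiplicative_isUMagmaMorphism.Build (G i) free_prod (@fp_in_fun i) (morph_one (@fp_in_funM i)).

Definition fp_in (i : I) : hom (G i) free_prod := @fp_in_fun i.

Section Lift.
Variables (H : groupType) (f : forall i, hom (G i) H).

Definition fp_pre_lift : hom (free_group {i : I & G i}) H :=
  free_lift (fun t : {i : I & G i} => f (projT1 t) (projT2 t)).

Lemma fp_pre_lift_ker x : normal_closure fp_relators x -> fp_pre_lift x = 1.
Proof.
move=> /(_ (kernel fp_pre_lift)); apply=> _ [i [a [b ->]]] /=.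
rewrite !gmulfM gmulfV.
by rewrite !free_lift_gen /= gmulfM mulgV.
Qed.

Definition fp_lift : hom free_prod H := quo_lift fp_pre_lift_ker.

Lemma fp_lift_in i (a : G i) : fp_lift (fp_in i a) = f i a.
Proof. by rewrite [LHS]quo_liftE free_lift_gen. Qed.

Lemma fp_lift_unique (phi psi : hom free_prod H) :
  (forall i (a : G i), phi (fp_in i a) = psi (fp_in i a)) -> phi =1 psi.
Proof.
move=> h c; have [x <-] := quo_proj_surj c.
pose p := quo_proj (normal_closure fp_relators).
by apply: (@free_lift_unique _ _ (phi \o p) (psi \o p)) => -[i a]; apply: h.
Qed.
End Lift.

End FreeProduct.

Definition A_free (A F : groupType) : Prop :=
  exists I : Type, isomorphic (free_prod (fun _ : I => A)) F.

Section AlgebraicGeometry.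
Variables (F : groupType) (n : nat).

Definition gword_factor (b : bool) : groupType :=
  if b then F else free_group 'I_n.

(* F[X] = F * F(x_1, ..., x_n) *)
Definition gword : groupType := free_prod gword_factor.

Definition gword_coef (c : F) : gword := fp_in gword_factor true c.
Definition gword_var (i : 'I_n) : gword := fp_in gword_factor false (free_gen i).

Definition affine := 'I_n -> F.

Definition gword_eval_factor (p : affine) (b : bool) :
    hom (gword_factor b) F :=
  match b return hom (gword_factor b) F with
  | true => idfun
  | false => free_lift p
  end.

(* The homomorphism F[X] -> F with c |-> c on F and x_i |-> p i. *)
Definition gword_eval (p : affine) : hom gword F :=
  fp_lift (gword_eval_factor p).

Lemma gword_eval_coef p c : gword_eval p (gword_coef c) = c.
Proof. by rewrite /gword_eval [LHS](fp_lift_in (gword_eval_factor p)). Qed.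

Lemma gword_eval_var p i : gword_eval p (gword_var i) = p i.
Proof.
rewrite /gword_eval [LHS](fp_lift_in (gword_eval_factor p)).
exact: free_lift_gen.
Qed.

Definition zero_locus (S : set gword) : set affine :=
  [set p | forall w, S w -> gword_eval p w = 1].

Definition algebraic_set (Y : set affine) : Prop :=
  exists S : set gword, Y = zero_locus S.

Definition finite_union_of_algebraic (C : set affine) : Prop :=
  exists s : seq (set gword), C = \big[setU/set0]_(S <- s) zero_locus S.

Definition zariski_closed (C : set affine) : Prop :=
  exists K : set (set affine), K `<=` finite_union_of_algebraic /\
    C = \bigcap_(D in K) D.

(* For an algebraic (hence closed) Y, relatively closed subsets of Y are the
   closed sets contained in Y. *)
Definition irreducible_algebraic_set (Y : set affine) : Prop :=
  [/\ algebraic_set Y, Y !=set0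
    & ~ (exists C1 C2 : set affine,
           [/\ zariski_closed C1, zariski_closed C2,
               C1 `<` Y, C2 `<` Y & Y = C1 `|` C2])].

Definition rad_set (Y : set affine) : set gword :=
  [set w | forall p, Y p -> gword_eval p w = 1].

Lemma rad_normal (Y : set affine) : is_normal_subgroup (rad_set Y).
Proof.
split; first split.
- by move=> p _; have [[]] := nsubP (kernel (gword_eval p)).
- move=> x y hx hy p Yp; have [[_ + _] _] := nsubP (kernel (gword_eval p)).
  by apply; [apply: hx | apply: hy].
- move=> x hx p Yp; have [[_ _ +] _] := nsubP (kernel (gword_eval p)).
  by apply; apply: hx.
- move=> x y hx p Yp; have [_ +] := nsubP (kernel (gword_eval p)).
  by apply; apply: hx.
Qed.

Definition Rad (Y : set affine) : normalSubgroup gword :=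
  NormalSubgroup (rad_normal Y).

Definition coordinate_group (Y : set affine) : groupType := quo (Rad Y).

End AlgebraicGeometry.

(* Main.v *)
Require Import Defs.
From HB Require Import structures.
From mathcomp Require Import all_boot.
From mathcomp Require Import boolp classical_sets.
From mathcomp Require Import ssralg ssrint zify.

(** Discrimination.  If [Y] is irreducible, any two nontrivial elements of
    Gamma(Y) survive under evaluation at a common point of [Y].  So, if [H] is
    nilpotent in Gamma(Y), [1 <> h] and both [h] and [h ^ x] lie in [H], it is
    enough to show that in [F] the images of [H] and [x] lie in a common
    nilpotent subgroup of class [k].

    Free products.  In a free product of copies of [A], let [z <> 1] be central
    in [H].  If [z] is conjugate into a factor then so are [H] and [x], factors
    being malnormal.  Otherwise [z] is conjugate to a cyclically reduced word,
    and [H] fixes the infinite reduced word [xi] given by its powers.  An element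
    fixing the end [xi] shifts its far prefixes by a constant number of letters,
    so the stabiliser of [xi] embeds in [Z].  The element [x] lies in it as well,
    unless it reverses the direction of [h]; then [x * x] is in the stabiliser,
    and so is [x] unless [x * x = 1].

    No involutions.  It remains to see that a finitely generated free nilpotent
    group [A] has no element of order 2.  By freeness it suffices to write [A]
    as a quotient of a nilpotent group of class [k] without involutions.  Such
    covers are built along a refinement of the lower central series with cyclic
    quotients: from a cover of [K] one covers [K<x>], with [x] of weight [m],
    by the semidirect product of [Z] with the group of those sequences [f] over
    the cover of [K] which lie above [n |-> a ^ (x ^ n)] for some [a] in [K] and
    are polynomial, i.e. whose j-th differences have weight increased by [j * m]
    (this is a group by the Lazard--Leibman theorem). *)


Set Implicit Arguments.
Unset Strict Implicit.
Unset Printing Implicit Defensive.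
Local Open Scope classical_set_scope.
Local Open Scope group_scope.

(** * Commutator identities and generated subgroups *)

Ltac group_word :=
  rewrite /commg /conjg ?(invgM, invgK, invg1, mulgA, mul1g, mulg1);
  rewrite ?(mulgK, mulgVK, mulgV, mulVg, mul1g, mulg1).

Section CommutatorIdentities.
Variable G : groupType.
Implicit Types x y z a b c : G.

Lemma commMgJ x y z : [~ x * y, z] = [~ x, z] ^ y * [~ y, z].
Proof. by group_word. Qed.

Lemma commgMJ x y z : [~ x, y * z] = [~ x, z] * [~ x, y] ^ z.
Proof. by group_word. Qed.

Lemma commVgJ x y : [~ x^-1, y] = ([~ x, y]^-1) ^ x^-1.
Proof. by group_word. Qed.

Lemma commgVJ x y : [~ x, y^-1] = ([~ x, y]^-1) ^ y^-1.
Proof. by group_word. Qed.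

Lemma conjg_mulR x y : x ^ y = x * [~ x, y].
Proof. by group_word. Qed.

Lemma Hall_Witt x y z :
  [~ x, y^-1, z] ^ y * [~ y, z^-1, x] ^ z * [~ z, x^-1, y] ^ x = 1.
Proof. by group_word. Qed.

(** A Leibniz rule for differences of commutators: with [a] and [b] the increments of [f] and [g],
    every factor on the right contains an increment. *)
Lemma commg_shift f a g b :
  [~ f, g]^-1 * [~ f * a, g * b] =
  ([~ f, b] ^ a) ^ [~ f, g] * [~ [~ f, g], b * a] * [~ a, b] * [~ a, g] ^ b.
Proof. by group_word. Qed.

End CommutatorIdentities.

Section Generated.
Variable G : groupType.
Implicit Types (S H : set G).

Definition generated S : set G :=
  [set x | forall H, is_subgroup H -> S `<=` H -> H x].

Lemma generated_subgroup S : is_subgroup (generated S).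
Proof.
split=> [H [] //|x y hx hy H sH SH|x hx H sH SH]; have [_ HM HV] := sH.
- by apply: HM; [apply: hx | apply: hy].
- by apply: HV; apply: hx.
Qed.

Lemma sub_generated S : S `<=` generated S.
Proof. by move=> x Sx H _; apply. Qed.

End Generated.

Lemma subgroupJ (G : groupType) (H : set G) x y :
  is_subgroup H -> H x -> H [~ x, y] -> H (x ^ y).
Proof. by case=> _ HM _ Hx Hxy; rewrite conjg_mulR; apply: HM. Qed.

(** * Filtrations and polynomial sequences *)

Section Filtration.
Variables (G : groupType) (Gf : nat -> set G).

(** The group being filtered is [Gf 0], which may be smaller than [G]; subgroups of a wreath product
    can thus be filtered without a type of their own. *)
Record filtration : Prop := Filtration {
  fil_subgroup : forall i, is_subgroup (Gf i);
  fil_le : forall i j, (i <= j)%N -> Gf j `<=` Gf i;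
  fil_comm : forall i j x y, Gf i x -> Gf j y -> Gf (i + j) [~ x, y] }.

Hypothesis hG : filtration.

Lemma fil1 i : Gf i 1.
Proof. by case: (fil_subgroup hG i). Qed.

Lemma filM i x y : Gf i x -> Gf i y -> Gf i (x * y).
Proof. by case: (fil_subgroup hG i) => _ + _; apply. Qed.

Lemma filV i x : Gf i x -> Gf i x^-1.
Proof. by case: (fil_subgroup hG i) => _ _; apply. Qed.

Lemma filJ i j x y : Gf i x -> Gf j y -> Gf i (x ^ y).
Proof.
move=> hx hy; apply: (subgroupJ (fil_subgroup hG i) hx).
exact: (fil_le hG (leq_addr j i) (fil_comm hG hx hy)).
Qed.

Lemma fil_lnc i x s : Gf i x -> (forall y, y \in s -> Gf 1 y) ->
  Gf (i + size s) (left_normed_comm x s).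
Proof.
elim: s i x => [|y s IH] i x hx hs /=; first by rewrite addn0.
rewrite addnS -addSn; apply: (IH i.+1 [~ x, y]) => [|z zs].
  by rewrite -addn1; apply: (fil_comm hG) => //; apply: hs; rewrite mem_head.
by apply: hs; rewrite in_cons zs orbT.
Qed.

End Filtration.

Lemma int_shift_ind (P : int -> Prop) :
  P 0%R -> (forall n, P n <-> P (n + 1)%R) -> forall n, P n.
Proof.
move=> P0 PS; case; elim=> [|n IH] //.
- by have /PS := IH; rewrite -PoszD addn1.
- by apply/PS.
- apply/PS; rewrite (_ : (Negz n.+1 + 1)%R = Negz n) //; lia.
Qed.

Section Sequences.
Variable G : groupType.

Definition zseq := int -> G.
HB.instance Definition _ := Choice.on zseq.

Definition zseq_mul (f g : zseq) : zseq := fun n => f n * g n.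
Definition zseq_one : zseq := fun=> 1.
Definition zseq_inv (f : zseq) : zseq := fun n => (f n)^-1.

Lemma zseq_mulA : associative zseq_mul.
Proof. by move=> f g h; apply/funext => n; apply: mulgA. Qed.
Lemma zseq_mul1 : left_id zseq_one zseq_mul.
Proof. by move=> f; apply/funext => n; apply: mul1g. Qed.
Lemma zseq_1mul : right_id zseq_one zseq_mul.
Proof. by move=> f; apply/funext => n; apply: mulg1. Qed.
Lemma zseq_mulV : left_inverse zseq_one zseq_inv zseq_mul.
Proof. by move=> f; apply/funext => n; apply: mulVg. Qed.
Lemma zseq_Vmul : right_inverse zseq_one zseq_inv zseq_mul.
Proof. by move=> f; apply/funext => n; apply: mulgV. Qed.

HB.instance Definition _ :=
  isGroup.Build zseq zseq_mulA zseq_mul1 zseq_1mul zseq_mulV zseq_Vmul.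

Definition zshift (e : int) (f : zseq) : zseq := fun n => f (n + e)%R.

Definition zdiff (f : zseq) : zseq := f^-1 * zshift 1%R f.

Lemma zshiftM e (f g : zseq) : zshift e (f * g) = zshift e f * zshift e g.
Proof. by []. Qed.

Lemma zshiftV e (f : zseq) : zshift e f^-1 = (zshift e f)^-1.
Proof. by []. Qed.

Lemma zshiftD e e' (f : zseq) : zshift e (zshift e' f) = zshift (e + e')%R f.
Proof. by apply/funext => n; rewrite /zshift GRing.addrA. Qed.

Lemma zshift0 (f : zseq) : zshift 0%R f = f.
Proof. by apply/funext => n; rewrite /zshift GRing.addr0. Qed.

Lemma zshift1 (f : zseq) : zshift 1%R f = f * zdiff f.
Proof. by rewrite /zdiff mulgA mulgV mul1g. Qed.

Lemma zdiff_shift e (f : zseq) : zdiff (zshift e f) = zshift e (zdiff f).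
Proof. by rewrite /zdiff !zshiftM zshiftV !zshiftD GRing.addrC. Qed.

Lemma zdiffM (f g : zseq) : zdiff (f * g) = zdiff f * [~ zdiff f, g] * zdiff g.
Proof. by rewrite {1}/zdiff zshiftM !zshift1; group_word. Qed.

Lemma zdiffV (f : zseq) : zdiff f^-1 = (zdiff f)^-1 ^ f^-1.
Proof. by rewrite {1}/zdiff zshiftV !zshift1; group_word. Qed.

Lemma zdiffR (f g : zseq) : let a := zdiff f in let b := zdiff g in
  zdiff [~ f, g] =
  ([~ f, b] ^ a) ^ [~ f, g] * [~ [~ f, g], b * a] * [~ a, b] * [~ a, g] ^ b.
Proof.
move=> a b; rewrite -commg_shift {1}/zdiff; congr (_ * _).
by rewrite -!zshift1.
Qed.

(** A discrete antiderivative: values of [d] are multiplied on to the right and divided off to the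
    left. As [Negz n] is [-(n + 1)], the left side takes [n.+1] factors. *)
Lemma zseq_prim (g : G) (d : zseq) :
  exists2 f : zseq, f 0%R = g & zdiff f = d.
Proof.
pose f (n : int) := match n with
  | Posz n => foldl (fun a i => a * d (Posz i)) g (iota 0 n)
  | Negz n => foldl (fun a i => a * (d (Negz i))^-1) g (iota 0 n.+1) end.
exists f => //; suff fS n : f (n + 1)%R = f n * d n.
  by apply/funext => n; rewrite -[RHS](mulKg (f n)) -fS.
case: n => n.
  by rewrite -PoszD addn1 /f -addn1 iotaD foldl_cat.
case: n => [|n]; first by rewrite /f /= mulgVK.
rewrite (_ : (Negz n.+1 + 1)%R = Negz n); last by lia.
by rewrite {2}/f -addn1 iotaD foldl_cat /= mulgVK.
Qed.

Section Polynomial.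
Variables (Gf : nat -> set G) (m : nat).

Fixpoint poly_upto (r l : nat) (f : zseq) : Prop :=
  (forall n, Gf l (f n)) /\ (if r is r'.+1 then poly_upto r' (l + m) (zdiff f) else True).

Definition poly_seq (l : nat) (f : zseq) : Prop := forall r, poly_upto r l f.

Lemma poly_upto_val r l f : poly_upto r l f -> forall n, Gf l (f n).
Proof. by case: r => [|r] []. Qed.

Lemma poly_uptoW r l f : poly_upto r.+1 l f -> poly_upto r l f.
Proof.
elim: r l f => [|r IH] l f [h1 h2]; first by split.
by split=> //; apply: IH.
Qed.

Lemma poly_upto_shift r l e f : poly_upto r l f -> poly_upto r l (zshift e f).
Proof.
elim: r l f => [|r IH] l f [h1 h2]; (split; first by move=> n; apply: h1) => //.
by rewrite zdiff_shift; apply: IH.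
Qed.

Hypothesis hG : filtration Gf.

(* Lazard--Leibman; the induction is on the number of differences, so that
   [f], [g] and [[~ f, g]] may all be used one level down. *)
Lemma poly_upto_filtration r : filtration (poly_upto r).
Proof.
elim: r => [|r IH].
  split=> [i|i j ij f [hf _]|i j f g [hf _] [hg _]].
  - split=> [|f g [hf _] [hg _]|f [hf _]]; split=> // n.
    + exact: fil1.
    + exact: filM.
    + exact: filV.
  - by split=> // n; apply: fil_le ij _ _.
  - by split=> // n; apply: fil_comm.
split=> [i|i j ij f [hf df]|i j f g hf hg].
- split=> [|f g hf hg|f hf].
  + split=> [n|]; first exact: fil1.
    have -> : zdiff 1 = 1 by apply/funext => n; apply: mulVg.
    exact: fil1.
  + have [vf df] := hf; have [vg dg] := hg; split=> [n|]; first exact: filM.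
    rewrite zdiffM; apply: (filM IH _ dg); apply: (filM IH df).
    have := fil_comm IH df (poly_uptoW hg); apply: (fil_le IH).
    by rewrite leq_addr.
  + have [vf df] := hf; split=> [n|]; first exact: filV.
    rewrite zdiffV; apply: (filJ IH (filV IH df)).
    by apply: (filV IH); apply: poly_uptoW hf.
- split=> [n|]; first by apply: fil_le ij _ _.
  by move: df; apply: (fil_le IH); rewrite leq_add2r.
- have [vf df] := hf; have [vg dg] := hg.
  have {}hf := poly_uptoW hf; have {}hg := poly_uptoW hg.
  split=> [n|]; first exact: fil_comm.
  have hfg := fil_comm IH hf hg.
  have hfb := fil_comm IH hf dg; rewrite addnA in hfb.
  have hag := fil_comm IH df hg; rewrite addnAC in hag.
  have hab := fil_comm IH df dg.
  rewrite zdiffR; apply: (filM IH); last exact: (filJ IH hag dg).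
  apply: (filM IH); last by move: hab; apply: (fil_le IH); lia.
  apply: (filM IH); first by apply: (filJ IH _ hfg); apply: (filJ IH hfb df).
  rewrite commgMJ; apply: (filM IH).
    by have := fil_comm IH hfg df; apply: (fil_le IH); lia.
  apply: (filJ IH _ df).
  by have := fil_comm IH hfg dg; apply: (fil_le IH); lia.
Qed.

Lemma poly_filtration : filtration poly_seq.
Proof.
split=> [i|i j ij f hf r|i j f g hf hg r].
- split=> [r|f g hf hg r|f hf r]; have hr := poly_upto_filtration r.
  + exact: fil1.
  + exact: filM.
  + exact: filV.
- exact: (fil_le (poly_upto_filtration r) ij (hf r)).
- exact: (fil_comm (poly_upto_filtration r) (hf r) (hg r)).
Qed.

Lemma poly_shift l e f : poly_seq l f -> poly_seq l (zshift e f).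
Proof. by move=> hf r; apply: poly_upto_shift. Qed.

Lemma poly_val l f : poly_seq l f -> forall n, Gf l (f n).
Proof. by move=> hf n; apply: (poly_upto_val (hf 0%N)). Qed.

Lemma poly_diff l f : poly_seq l f -> poly_seq (l + m) (zdiff f).
Proof. by move=> hf r; have [] := hf r.+1. Qed.

Lemma poly_of_diff l f :
  (forall n, Gf l (f n)) -> poly_seq (l + m) (zdiff f) -> poly_seq l f.
Proof. by move=> h1 h2 [|r]; split. Qed.

(** Telescoping: a difference of step [e] is built from translates of [zdiff f] and their inverses.
    Commutators with powers of [t] take this form in the wreath product. *)
Lemma poly_diff_shift l e f : poly_seq l f -> poly_seq (l + m) (f^-1 * zshift e f).
Proof.
move=> hf; have hP := poly_filtration; move: e; apply: int_shift_ind => [|e].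
  by rewrite zshift0 mulVg; apply: (fil1 hP).
have -> : f^-1 * zshift (e + 1)%R f = f^-1 * zshift e f * zshift e (zdiff f).
  by rewrite -zshiftD zshift1 zshiftM mulgA.
have hd : poly_seq (l + m) (zshift e (zdiff f)) by apply/poly_shift/poly_diff.
split=> [h|h]; first exact: (filM hP).
by rewrite -[X in poly_seq _ X](mulgK (zshift e (zdiff f))); apply: (filM hP) => //; apply: (filV hP).
Qed.

End Polynomial.

End Sequences.

(** * The wreath product with the integers, and integer powers *)

Section Wreath.
Variable G : groupType.

Definition wreath := (zseq G * int)%type.
HB.instance Definition _ := Choice.on wreath.

(* The pair [(f, e)] stands for [f * t ^ e], where [f ^ t] is the shift of [f]. *)
Definition wr_mul (u v : wreath) : wreath :=
  (u.1 * zshift (- u.2)%R v.1, (u.2 + v.2)%R).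
Definition wr_one : wreath := (1, 0%R).
Definition wr_inv (u : wreath) : wreath := (zshift u.2 u.1^-1, (- u.2)%R).

Lemma wr_mulA : associative wr_mul.
Proof.
move=> [f e] [g e'] [h e'']; rewrite /wr_mul /=; congr (_, _).
  by rewrite zshiftM zshiftD mulgA GRing.opprD.
by rewrite GRing.addrA.
Qed.
Lemma wr_mul1 : left_id wr_one wr_mul.
Proof. by move=> [f e]; rewrite /wr_mul /= GRing.oppr0 zshift0 mul1g GRing.add0r. Qed.
Lemma wr_1mul : right_id wr_one wr_mul.
Proof. by move=> [f e]; rewrite /wr_mul /= [zshift _ 1]/(1 : zseq G) mulg1 GRing.addr0. Qed.
Lemma wr_mulV : left_inverse wr_one wr_inv wr_mul.
Proof.
by move=> [f e]; rewrite /wr_mul /= GRing.opprK -zshiftM mulVg GRing.addNr.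
Qed.
Lemma wr_Vmul : right_inverse wr_one wr_inv wr_mul.
Proof.
move=> [f e]; rewrite /wr_mul /= zshiftD GRing.addNr GRing.addrN zshift0.
by rewrite mulgV.
Qed.

HB.instance Definition _ :=
  isGroup.Build wreath wr_mulA wr_mul1 wr_1mul wr_mulV wr_Vmul.

Lemma wr_mulE (f g : zseq G) (e e' : int) :
  ((f, e) : wreath) * (g, e') = (f * zshift (- e)%R g, (e + e')%R).
Proof. by []. Qed.

End Wreath.

Section IntegerPowers.
Variable G : groupType.
Implicit Types (x : G) (e : int).

Definition zpow x e : G :=
  match e with Posz n => x ^+ n | Negz n => x ^- n.+1 end.

Lemma zpowS x e : zpow x (e + 1)%R = zpow x e * x.
Proof.
case: e => [n|[|n]].
- by rewrite -PoszD addn1 [LHS]expgSr.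
- by rewrite [LHS]/1 /= mulVg.
- rewrite (_ : (Negz n.+1 + 1)%R = Negz n); last by lia.
  by rewrite /zpow [x ^+ n.+2]expgS invgM mulgVK.
Qed.

Lemma zpowD x e e' : zpow x (e + e')%R = zpow x e * zpow x e'.
Proof.
move: e'; apply: int_shift_ind => [|e']; first by rewrite GRing.addr0 mulg1.
by rewrite GRing.addrA !zpowS mulgA; split=> [->|/mulIg].
Qed.

Lemma zpowN x e : zpow x (- e)%R = (zpow x e)^-1.
Proof. by apply: (mulIg (zpow x e)); rewrite -zpowD GRing.addNr mulVg. Qed.

Lemma zpow_subgroup (H : set G) x e : is_subgroup H -> H x -> H (zpow x e).
Proof.
move=> [H1 HM HV] Hx; move: e; apply: int_shift_ind => [//|e]; rewrite zpowS.
split=> [he|he]; first exact: HM.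
by rewrite -[zpow x e](mulgK x); apply: (HM) => //; apply: HV.
Qed.

End IntegerPowers.

(** * The lower central series *)

Section LowerCentral.
Variable G : groupType.
Implicit Types (x y a b : G).

(* [lcs n] is the (n+1)-st term of the lower central series. *)
Fixpoint lcs (n : nat) : set G :=
  if n is n'.+1 then generated [set z | exists2 a, lcs n' a & exists b, z = [~ a, b]]
  else setT.
Arguments lcs : simpl never.

Lemma lcs_subgroup n : is_subgroup (lcs n).
Proof. by case: n => [|n] //; apply: generated_subgroup. Qed.

Lemma lcs_commT n a b : lcs n a -> lcs n.+1 [~ a, b].
Proof. by move=> ha; apply: sub_generated; exists a => //; exists b. Qed.

Lemma lcsJ n x y : lcs n x -> lcs n (x ^ y).
Proof.
elim: n x y => [//|n IH] x y hx; have [D1 DM DV] := lcs_subgroup n.+1.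
apply: (hx [set x | lcs n.+1 (x ^ y)]) => [|_ [a ha [b ->]]] /=.
  by split=> /= [|u v|u]; rewrite ?conj1g ?conjMg ?conjVg //; [apply: DM|apply: DV].
by rewrite conjRg; apply: lcs_commT; apply: IH.
Qed.

Lemma lcsS n : lcs n.+1 `<=` lcs n.
Proof.
have [D1 DM DV] := lcs_subgroup n.
move=> x; apply; first exact: lcs_subgroup.
by move=> _ [a ha [b ->]]; apply: (DM); [apply: DV|apply: lcsJ].
Qed.

Lemma lcs_le i j : (i <= j)%N -> lcs j `<=` lcs i.
Proof.
move=> /subnKC <-; elim: (j - i)%N => [|n IH]; first by rewrite addn0.
by rewrite addnS => x /lcsS; apply: IH.
Qed.

(** Three subgroups argument by induction on [j]: for [a] in [lcs j], [Hall_Witt] expresses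
    [[~ a, b, x]] through [[~ b^-1, x^-1, a]] and [[~ x, a^-1, b^-1]], to which the hypothesis for
    [j] applies. The extra successor appears because [lcs n] has weight [n + 1]. *)
Lemma lcs_comm i j x y : lcs i x -> lcs j y -> lcs (i + j).+1 [~ x, y].
Proof.
elim: j i x y => [|j IH] i x y hx hy; first by rewrite addn0; apply: lcs_commT.
have [D1 DM DV] := lcs_subgroup (i + j.+1).+1.
apply: (hy [set y | lcs (i + j.+1).+1 [~ x, y]]) => [|_ [a ha [b ->]]] /=.
  split=> /= [|u v hu hv|u hu].
  - by rewrite commg1.
  - by rewrite commgMJ; apply: (DM) => //; apply: lcsJ.
  - by rewrite commgVJ; apply: lcsJ; apply: DV.
rewrite -invgR; apply: (DV).
have h2 : lcs (i + j.+1).+1 [~ b^-1, x^-1, a].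
  rewrite -addSnnS; apply: (IH i.+1) => //.
  have [_ _ V1] := lcs_subgroup i.+1; have [_ _ V0] := lcs_subgroup i.
  by rewrite -invgR; apply: V1; apply: lcs_commT; apply: V0.
have h3 : lcs (i + j.+1).+1 [~ x, a^-1, b^-1].
  rewrite addnS; apply: lcs_commT; apply: IH => //.
  by have [_ _ V0] := lcs_subgroup j; apply: V0.
have := Hall_Witt a b^-1 x; rewrite invgK => HW.
rewrite -[[~ a, b, x]](conjgKV b); apply: lcsJ.
suff -> : [~ a, b, x] ^ b^-1 = ([~ x, a^-1, b^-1] ^ a)^-1 * ([~ b^-1, x^-1, a] ^ x)^-1.
  by apply: (DM); apply: (DV); apply: lcsJ.
by apply/eqP; rewrite -invgM -mulg_eq1 mulgA HW.
Qed.

(** Indexed by weight: the predecessor makes levels 0 and 1 both the whole group. *)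
Lemma lcs_filtration : filtration (fun i => lcs i.-1).
Proof.
split=> [i|i j ij|[|i] [|j] x y hx hy].
- exact: lcs_subgroup.
- by apply: lcs_le; lia.
- by [].
- rewrite add0n /=; have [_ DM DV] := lcs_subgroup j.
  by rewrite -invgR; apply: (DV); apply: (DM); [apply: DV|apply: lcsJ].
- rewrite addn0 /=; have [_ DM DV] := lcs_subgroup i.
  by apply: (DM); [apply: DV|apply: lcsJ].
- by rewrite addnS; apply: lcs_comm.
Qed.

Fixpoint ucs (n : nat) (x : G) : Prop :=
  if n is n'.+1 then forall b, ucs n' [~ x, b] else x = 1.

Lemma ucs_normal n : is_normal_subgroup (ucs n).
Proof.
elim: n => [|n [[U1 UM UV] UJ]].
  by split=> [|x y ->]; rewrite ?conj1g //; split=> [|x y -> ->|x ->]; rewrite ?mulg1 ?invg1.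
have UJ' x y : ucs n.+1 x -> ucs n.+1 (x ^ y).
  by move=> hx b; rewrite -(conjgKV y b) -conjRg; apply: UJ.
split=> //; split=> [b|x y hx hy b|x hx b].
- by rewrite comm1g.
- by rewrite commMgJ; apply: (UM) => //; apply: UJ.
- by rewrite commVgJ; apply: (UJ); apply: UV.
Qed.

Lemma ucs_law n x :
  (forall s, size s = n -> left_normed_comm x s = 1) -> ucs n x.
Proof.
elim: n x => [|n IH] x h; first exact: (h [::]).
by move=> b; apply: IH => s hs; apply: (h (b :: s)); rewrite /= hs.
Qed.

(** The identity concerns only simple commutators, so the descending series is compared with the
    upper central series [ucs]: the identity puts every element in [ucs k], and each commutator goes
    one step down in both series. *)
Lemma lcs_nilpotent k x : nilpotent_group k G -> lcs k x -> x = 1.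
Proof.
move=> nG; suff h i : (i <= k)%N -> lcs i `<=` ucs (k - i).
  by move=> /(h k (leqnn k)); rewrite subnn.
elim: i => [|i IH] ik y hy.
  by rewrite subn0; apply: ucs_law => s hs; apply: nG.
apply: hy => [|_ [a ha [b ->]]]; first by have [] := ucs_normal (k - i.+1).
by have := IH (ltnW ik) a ha; rewrite -(subnSK ik) => /(_ b).
Qed.

(** Finite generation of [lcs n] modulo [lcs n.+1], phrased with subgroups [H] above [lcs n.+1] to
    avoid quotients. Commutators of generators suffice at the next level because the commutator is
    bilinear modulo the term after it. *)
Lemma lcs_fg n : finitely_generated G ->
  exists2 s : seq G, forall x, x \in s -> lcs n x &
    forall H, is_subgroup H -> (forall x, x \in s -> H x) -> lcs n.+1 `<=` H ->
      lcs n `<=` H.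
Proof.
move=> [s0 hs0]; elim: n => [|n [s sD sH]].
  by exists s0 => // H gH sH _ x _; rewrite (hs0 H gH sH).
exists [seq [~ a, b] | a <- s, b <- s0].
  by move=> _ /allpairsP[[a b] [/sD ha hb ->]]; apply: lcs_commT.
move=> H gH gens DH; have [H1 HM HV] := gH.
have HJ x y : lcs n.+1 x -> H x -> H (x ^ y).
  by move=> Dx Hx; apply: (subgroupJ gH Hx); apply: (DH); apply: lcs_commT.
have [D1 DM DV] := lcs_subgroup n.
have sT a : a \in s -> forall b, H [~ a, b].
  move=> as_ b; have Da := sD _ as_.
  have : [set b | H [~ a, b]] = setT.
    apply: hs0 => [|c cs] /=; last by apply: gens; apply/allpairsP; exists (a, c).
    split=> /= [|u v hu hv|u hu].
    - by rewrite commg1.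
    - by rewrite commgMJ; apply: (HM) => //; apply: (HJ) => //; apply: lcs_commT.
    - rewrite commgVJ; apply: (HJ); last exact: HV.
      by have [_ _ V] := lcs_subgroup n.+1; apply: V; apply: lcs_commT.
  by move/(congr1 (@^~ b)) => /= ->.
suff nH : lcs n `<=` [set a | lcs n a /\ forall b, H [~ a, b]].
  by move=> x; apply=> // _ [a /nH[_ ha] [b ->]].
apply: sH => [|x xs|x Dx] /=; first split=> /= [|u v [Du hu] [Dv hv]|u [Du hu]].
- by split=> // b; rewrite comm1g.
- split=> [|b]; first exact: DM.
  by rewrite commMgJ; apply: (HM) => //; apply: (HJ) => //; apply: lcs_commT.
- split=> [|b]; first exact: DV.
  rewrite commVgJ; apply: (HJ); last exact: HV.
  by have [_ _ V] := lcs_subgroup n.+1; apply: V; apply: lcs_commT.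
- by split; [apply: sD|apply: sT].
- by split=> [|b]; [apply: lcsS|apply: (DH); apply: lcs_commT].
Qed.

End LowerCentral.

(** * Free nilpotent groups have no involutions *)

Definition no_involution (G : groupType) (H : set G) : Prop :=
  forall x, H x -> x * x = 1 -> x = 1.

Section Covers.
Variables (k : nat) (A : groupType).

Definition gamma (i : nat) : set A := lcs i.-1.

(** Here [phi] matters on [Gf 0] only. The field [coverP] makes the image of each level exactly the
    part of [N] of that weight, so elements lift without loss of weight. *)
Record cover (N : set A) (G : groupType) (Gf : nat -> set G) (phi : G -> A) : Prop :=
  Cover {
    cover_fil : filtration Gf;
    cover_nil : forall g, Gf k.+1 g -> g = 1;
    cover_inv : no_involution (Gf 0);
    coverM : forall g h, Gf 0 g -> Gf 0 h -> phi (g * h) = phi g * phi h;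
    coverP : forall i x, N x /\ gamma i x <-> exists2 g, Gf i g & phi g = x }.

Definition covered (N : set A) : Prop :=
  exists (G : groupType) (Gf : nat -> set G) (phi : G -> A), cover N Gf phi.

Section Step.
Variables (K : set A) (m : nat) (x : A).
Hypotheses (gK : gamma m.+2 `<=` K) (Kg : K `<=` gamma m.+1).
Hypothesis (mk : (m < k)%N) (gx : gamma m.+1 x).
Variables (G : groupType) (Gf : nat -> set G) (phi : G -> A).
Hypothesis cK : cover K Gf phi.

Let hG := cover_fil cK.
Let hA : filtration gamma := lcs_filtration A.

Definition adjoin_set : set A := [set y | exists2 a, K a & exists e, y = a * zpow x e].

Definition equivariant (f : zseq G) : Prop :=
  forall n, phi (f (n + 1)%R) = phi (f n) ^ x.

(** The letter [t] lies over [x] and receives its weight [m.+1], so beyond that level the exponent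
    must vanish. *)
Definition adjoin_fil (l : nat) : set (wreath G) :=
  [set u | [/\ poly_seq Gf m.+1 l u.1, equivariant u.1 & (m.+1 < l)%N -> u.2 = 0%R]].

Definition adjoin_map (u : wreath G) : A := phi (u.1 0%R) * zpow x u.2.

Let hP : filtration (poly_seq Gf m.+1) := poly_filtration m.+1 hG.

Let G0 l g : Gf l g -> Gf 0 g.
Proof. exact: (fil_le hG (leq0n l)). Qed.

Let P0 l f n : poly_seq Gf m.+1 l f -> Gf 0 (f n).
Proof. by move=> hf; apply: (@G0 l); apply: (poly_val hf). Qed.

Lemma cover1 : phi 1 = 1.
Proof. by apply: (mulgI (phi 1)); rewrite -(coverM cK) ?mulg1 //; apply: (fil1 hG). Qed.

Lemma coverV g : Gf 0 g -> phi g^-1 = (phi g)^-1.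
Proof.
move=> hg; apply: (mulgI (phi g)); rewrite -(coverM cK) ?mulgV ?cover1 //.
exact: (filV hG).
Qed.

Lemma equivariant_zpow f n : equivariant f -> phi (f n) = phi (f 0%R) ^ zpow x n.
Proof.
move=> ef; move: n; apply: int_shift_ind => [|n]; first by rewrite conjg1.
by rewrite ef zpowS conjgM; split=> [->|/conjg_inj].
Qed.

Lemma equivariantM l f g : poly_seq Gf m.+1 l f -> poly_seq Gf m.+1 l g ->
  equivariant f -> equivariant g -> equivariant (f * g).
Proof.
move=> hf hg ef eg n; have h0 i := P0 i hf; have h1 i := P0 i hg.
by rewrite [LHS](coverM cK) // ef eg -conjMg -(coverM cK).
Qed.

Lemma equivariantV l f : poly_seq Gf m.+1 l f -> equivariant f -> equivariant f^-1.
Proof.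
move=> hf ef n; have h0 i := P0 i hf.
by rewrite [LHS]coverV // ef -conjVg -coverV.
Qed.

Lemma equivariant_shift e f : equivariant f -> equivariant (zshift e f).
Proof. by move=> ef n; rewrite /zshift GRing.addrAC ef. Qed.

Lemma adjoin_fil_subgroup l : is_subgroup (adjoin_fil l).
Proof.
split=> [|[f e] [g e'] [/= hf ef he] [/= hg eg he']|[f e] [/= hf ef he]].
- split=> //=; first exact: (fil1 hP).
  by move=> n; rewrite /= [RHS]/(_ ^ _) [(1 : zseq G) _]/(1 : G) cover1 mul1g mulVg.
- split=> /=.
  + by apply: (filM hP) => //; apply: poly_shift.
  + apply: (equivariantM hf) => //; first exact: poly_shift.
    exact: equivariant_shift.
  + by move=> lm; rewrite he // he'.
- split=> /=.
  + by apply: poly_shift; apply: (filV hP).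
  + by apply: equivariant_shift; apply: (equivariantV hf).
  + by move=> lm; rewrite he // GRing.oppr0.
Qed.

(** Up to a translation, this separates the three sources of weight: [f] against a power of [t], [f]
    against [g], and [g] against a power of [t]. *)
Lemma wr_commE (f g : zseq G) (e e' : int) :
  [~ (f, e) : wreath G, (g, e')] =
  (zshift (e + e')%R ((f^-1 * zshift (- e')%R f)^-1 * [~ f, g] *
                      (g^-1 * zshift (- e)%R g)), 0%R).
Proof.
have -> (u v : wreath G) : [~ u, v] = (v * u)^-1 * (u * v) by group_word.
rewrite [LHS]/(wr_mul (wr_inv (wr_mul _ _)) (wr_mul _ _)) /wr_mul /wr_inv /= GRing.opprK.
rewrite [(e' + e)%R]GRing.addrC GRing.addNr -zshiftM; congr (zshift _ _, _).
by group_word.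
Qed.

Lemma adjoin_fil_filtration : filtration adjoin_fil.
Proof.
split=> [i|i j ij [f e] [/= hf ef he]|i j [f e] [g e'] hu hv].
- exact: adjoin_fil_subgroup.
- by split=> //= [|im]; [apply: (fil_le hP ij)|apply: he; apply: leq_trans ij].
have adj0 l u : adjoin_fil l u -> adjoin_fil 0 u.
  by move=> [hf ef _]; split=> //; apply: (fil_le hP (leq0n l)).
have eqR : equivariant [~ (f, e) : wreath G, (g, e')].1.
  have [_ M V] := adjoin_fil_subgroup 0.
  have := M _ _ (V _ (adj0 _ _ hu))
            (M _ _ (V _ (adj0 _ _ hv)) (M _ _ (adj0 _ _ hu) (adj0 _ _ hv))).
  by case.
have [/= hf ef he] := hu; have [/= hg eg he'] := hv.
split=> //; last by rewrite wr_commE.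
(* If [b] is at most [m.+1], any difference of [h] already gains [m.+1]; otherwise the exponent [d]
   is 0 and the difference is trivial. *)
have drop a b h d : poly_seq Gf m.+1 a h -> ((m.+1 < b)%N -> d = 0%R) ->
    poly_seq Gf m.+1 (a + b) (h^-1 * zshift (- d)%R h).
  move=> hh hd; case: (leqP b m.+1) => [bm|/hd ->].
    by have := poly_diff_shift hG (- d)%R hh; apply: (fil_le hP); rewrite leq_add2l.
  by rewrite GRing.oppr0 zshift0 mulVg; apply: (fil1 hP).
rewrite wr_commE /=; apply: poly_shift; apply: (filM hP); last first.
  by rewrite addnC; apply: drop.
apply: (filM hP); last exact: (fil_comm hP).
by apply: (filV hP); apply: drop.
Qed.

(* Choose lifts of [a], [~ a, x], [~ a, x, x], ... and sum them up. *)
Lemma equivariant_lift l a : K a -> gamma l a ->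
  exists2 f, poly_seq Gf m.+1 l f /\ equivariant f & phi (f 0%R) = a.
Proof.
(* Descending induction on the weight [l], with [N] as fuel: past weight [k] the cover is trivial,
   so the element to be lifted is 1. *)
suff lift N : forall l a, (k < l + N)%N -> K a -> gamma l a ->
    exists2 f, poly_seq Gf m.+1 l f & forall n, phi (f n) = a ^ zpow x n.
  have kl : (k < l + k.+1)%N by lia.
  move=> Ka ga; have [f hf fE] := lift k.+1 l a kl Ka ga.
  exists f; last by rewrite fE conjg1.
  by split=> // n; rewrite !fE zpowS conjgM.
elim: N => [|N IH] {}l {}a kl Ka ga.
  have [g gl ga'] := (coverP cK l a).1 (conj Ka ga).
  have g1 : g = 1 by apply: (cover_nil cK); apply: (fil_le hG _ gl); lia.
  exists 1; first exact: (fil1 hP).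
  by move=> n; rewrite -ga' g1 [(1 : zseq G) n]/(1 : G) cover1 conj1g.
have gax := fil_comm hA ga gx.
have Kax : K [~ a, x].
  apply: gK; have := fil_comm hA (Kg Ka) gx; apply: (fil_le hA); lia.
have [|d hd dE] := IH _ _ _ Kax gax; first by lia.
have [g gl ga'] := (coverP cK l a).1 (conj Ka ga).
have [f f0 df] := zseq_prim g d.
have fS n : f (n + 1)%R = f n * d n by rewrite -df [RHS]mulVKg.
have dl n : Gf l (d n).
  by have := poly_val hd n; apply: (fil_le hG); apply: leq_addr.
have fl : forall n, Gf l (f n).
  apply: int_shift_ind => [|n]; first by rewrite f0.
  rewrite fS; split=> [h|h]; first exact: (filM hG).
  by rewrite -[f n](mulgK (d n)); apply: (filM hG h); apply: (filV hG).
exists f; first by apply: poly_of_diff => //; rewrite df.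
apply: int_shift_ind => [|n]; first by rewrite f0 conjg1.
rewrite fS (coverM cK) ?dE; [|exact: G0 (fl _)|exact: G0 (dl _)].
have -> : a ^ zpow x (n + 1)%R = a ^ zpow x n * [~ a, x] ^ zpow x n.
  by rewrite [(n + 1)%R]GRing.addrC zpowD conjgM -conjMg -conjg_mulR.
by split=> [->|/mulIg].
Qed.

Lemma zpow_gamma l e : (l <= m.+1)%N -> gamma l (zpow x e).
Proof.
move=> lm; apply: zpow_subgroup; first exact: (fil_subgroup hA).
exact: (fil_le hA lm).
Qed.

Lemma cover_adjoin : cover adjoin_set adjoin_fil adjoin_map.
Proof.
split.
- exact: adjoin_fil_filtration.
- move=> [f e] [/= hf ef he].
  have f1 : f = 1 by apply/funext => n; apply: (cover_nil cK); apply: (poly_val hf).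
  by rewrite f1 he.
- move=> [f e] [/= hf ef he]; rewrite wr_mulE => -[ff ee].
  (* The square has exponent [e + e]; once [e] is 0, the values of [f] themselves square to 1 in the
     smaller cover. *)
  have e0 : e = 0%R by lia.
  move: ff; rewrite e0 GRing.oppr0 zshift0 => ff; congr (_, _).
  apply/funext => n; apply: (cover_inv cK); first exact: (P0 _ hf).
  by rewrite -[RHS]/((1 : zseq G) n) -ff.
- move=> [f e] [g e'] [/= hf ef _] [/= hg eg _]; rewrite /adjoin_map /=.
  rewrite [in LHS](coverM cK); [|exact: P0 hf|exact: P0 (poly_shift _ hg)].
  rewrite /zshift GRing.add0r (equivariant_zpow _ eg) zpowN zpowD.
  by rewrite /conjg invgK !mulgA mulgVK.
- move=> l y; split=> [[[a Ka [e ->]] gy]|[[f e] [/= hf ef he] <-]].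
  + case: (leqP l m.+1) => lm.
      have ga : gamma l a.
        rewrite -[a](mulgK (zpow x e)); apply: (filM hA gy); apply: (filV hA).
        exact: zpow_gamma.
      have [f [hf ef] f0] := equivariant_lift Ka ga.
      by exists (f, e); [split=> //=; lia|rewrite /adjoin_map /= f0].
    (* Above weight [m.+1] the factors [a] and [zpow x e] need not have the weight of their product,
       but the product lies in [K] and is lifted with exponent 0. *)
    have Ky : K (a * zpow x e) by apply: gK; apply: (fil_le hA lm gy).
    have [f [hf ef] f0] := equivariant_lift Ky gy.
    by exists (f, 0%R); [split|rewrite /adjoin_map /= f0 mulg1].
  + have [Kf gf] := (coverP cK l (phi (f 0%R))).2 (ex_intro2 _ _ _ (poly_val hf 0%R) erefl).
    split; first by exists (phi (f 0%R)) => //; exists e.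
    apply: (filM hA gf); case: (leqP l m.+1) => [lm|/he ->].
      exact: zpow_gamma.
    exact: (fil1 hA).
Qed.

End Step.
End Covers.

Section SubgroupType.
Variables (G : groupType) (H : set G) (sH : is_subgroup H).

(** The proof that [H] is a subgroup is a parameter of the type, so that the group structure can be
    inferred from the type alone. *)
Definition subgrp of is_subgroup H := {x : G | `[< H x >]}.
HB.instance Definition _ := Choice.on (subgrp sH).

Definition sg_val (u : subgrp sH) : G := sval u.

Lemma sg_valP u : H (sg_val u).
Proof. by apply/asboolP; apply: (svalP u). Qed.

Definition sg_sub x (Hx : H x) : subgrp sH := exist _ x (asboolT Hx).

Lemma sg_val_inj : injective sg_val.
Proof. by move=> u v uv; apply: val_inj. Qed.

Let H1 : H 1. Proof. by case: sH. Qed.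
Let HM x y : H x -> H y -> H (x * y). Proof. by case: sH => _ + _; apply. Qed.
Let HV x : H x -> H x^-1. Proof. by case: sH => _ _; apply. Qed.

Definition sg_mul u v := sg_sub (HM (sg_valP u) (sg_valP v)).
Definition sg_one := sg_sub H1.
Definition sg_inv u := sg_sub (HV (sg_valP u)).

Lemma sg_mulA : associative sg_mul.
Proof. by move=> u v w; apply: sg_val_inj; apply: mulgA. Qed.
Lemma sg_mul1 : left_id sg_one sg_mul.
Proof. by move=> u; apply: sg_val_inj; apply: mul1g. Qed.
Lemma sg_1mul : right_id sg_one sg_mul.
Proof. by move=> u; apply: sg_val_inj; apply: mulg1. Qed.
Lemma sg_mulV : left_inverse sg_one sg_inv sg_mul.
Proof. by move=> u; apply: sg_val_inj; apply: mulVg. Qed.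
Lemma sg_Vmul : right_inverse sg_one sg_inv sg_mul.
Proof. by move=> u; apply: sg_val_inj; apply: mulgV. Qed.

HB.instance Definition _ :=
  isGroup.Build (subgrp sH) sg_mulA sg_mul1 sg_1mul sg_mulV sg_Vmul.

Lemma sg_valM : {morph sg_val : u v / u * v}.
Proof. by []. Qed.

End SubgroupType.

Definition mkhom (G H : groupType) (f : G -> H) (fM : {morph f : x y / x * y}) :
  hom G H := HB.pack f (isMultiplicative.Build G H f fM)
               (Multiplicative_isUMagmaMorphism.Build G H f (morph_one fM)).

Lemma hom_lnc (G H : groupType) (f : hom G H) x s :
  f (left_normed_comm x s) = left_normed_comm (f x) (map f s).
Proof. by elim: s x => //= y s IH x; rewrite IH gmulfR. Qed.

Section FreeNilpotent.
Variables (k : nat) (A : groupType).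
Hypotheses (fgA : finitely_generated A) (nA : nilpotent_group k A).

Lemma adjoin_subgroup (K : set A) n (x : A) : is_subgroup K ->
  lcs n.+1 `<=` K -> K `<=` lcs n -> is_subgroup (adjoin_set K x).
Proof.
move=> sK nK Kn; have [K1 KM KV] := sK.
have KJ a y : K a -> K (a ^ y).
  by move=> Ka; apply: (subgroupJ sK Ka); apply: nK; apply: lcs_commT; apply: Kn.
split.
- by exists 1 => //; exists 0%R; rewrite mulg1.
- move=> _ _ [a Ka [e ->]] [b Kb [e' ->]].
  exists (a * b ^ zpow x (- e)%R); first by apply: KM => //; apply: KJ.
  by exists (e + e')%R; rewrite zpowD zpowN; group_word.
- move=> _ [a Ka [e ->]]; exists (a^-1 ^ zpow x e); first by apply: KJ; apply: KV.
  by exists (- e)%R; rewrite zpowN; group_word.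
Qed.

(** Adjoining the elements of [s] one by one gives the refinement of the series by cyclic quotients;
    all intermediate groups stay between [lcs n.+1] and [lcs n]. *)
Lemma covered_adjoin_seq n (s : seq A) : (n < k)%N -> covered k (lcs (n.+1) : set A) ->
  (forall x, x \in s -> lcs n x) ->
  exists K, [/\ is_subgroup K, lcs n.+1 `<=` K, K `<=` lcs n, covered k K &
    forall x, x \in s -> K x].
Proof.
move=> nk cn; elim: s => [|x s IH] sn.
  by exists (lcs n.+1); split=> //; [apply: lcs_subgroup|apply: lcsS].
have [|K [sK nK Kn [G [Gf [phi cK]]] Ks]] := IH.
  by move=> y ys; apply: sn; rewrite in_cons ys orbT.
have nx : lcs n x by apply: sn; rewrite mem_head.
have KA y : K y -> adjoin_set K x y.
  by move=> Ky; exists y => //; exists 0%R; rewrite mulg1.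
exists (adjoin_set K x); split.
- exact: (adjoin_subgroup x sK nK Kn).
- by move=> y /nK; apply: KA.
- move=> _ [a /Kn na [e ->]]; have [_ DM _] := lcs_subgroup A n.
  by apply: DM => //; apply: zpow_subgroup => //; apply: lcs_subgroup.
- by do 3 eexists; apply: (@cover_adjoin k A K n x nK Kn nk nx _ _ _ cK).
- move=> y; rewrite in_cons => /predU1P[->|/Ks]; last exact: KA.
  by exists 1; [case: sK|exists 1%R; rewrite mul1g].
Qed.

Lemma covered_lcs i : (i <= k)%N -> covered k (lcs (k - i) : set A).
Proof.
elim: i => [_|i IH ik].
  (* The climb starts at [lcs k], which is trivial and is covered by the trivial subgroup of [A]. *)
  rewrite subn0; exists A, (fun=> [set 1]), id; split=> //.
  - split=> [i|i j _ x|i j x y -> ->] //; last by rewrite /= commgg.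
    by split=> // [x y -> ->|x ->]; rewrite /= ?mulg1 ?invg1.
  - move=> i x; split=> [[/(lcs_nilpotent nA) -> _]|[_ -> <-]]; first by exists 1.
    split; first by case: (lcs_subgroup A k).
    by case: (lcs_subgroup A i.-1).
have [s sn sH] := lcs_fg (k - i.+1) fgA.
have cn : covered k (lcs (k - i.+1).+1 : set A) by rewrite subnSK //; apply: IH; apply: ltnW.
have [|K [sK nK Kn cK Ks]] := covered_adjoin_seq _ cn sn; first by lia.
suff <- : K = lcs (k - i.+1) by [].
by apply/seteqP; split=> //; apply: sH.
Qed.

End FreeNilpotent.

Lemma free_nilpotent_no_involution k (A : groupType) :
  finitely_generated A -> free_nilpotent k A -> no_involution [set: A].
Proof.
move=> fgA [B [b [nA freeA]]].
have := covered_lcs fgA nA (leqnn k); rewrite subnn => -[G [Gf [phi c]]].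
have hG := cover_fil c.
(* Level 1 is taken because commutators of [k.+1] of its elements fall in level [k.+1], which is
   trivial; it still maps onto [A], since [gamma 1] is everything. *)
pose sG := fil_subgroup hG 1; pose S : groupType := subgrp sG; pose sval := @sg_val _ _ sG.
have S0 (u : S) : Gf 0 (sval u) by apply: (fil_le hG (leq0n 1)); apply: sg_valP.
have nS : nilpotent_group k S.
  move=> u s sk _ _; apply: sg_val_inj; rewrite [LHS](hom_lnc (mkhom (@sg_valM _ _ sG))).
  apply: (cover_nil c); rewrite -sk -add1n -(size_map sval s).
  apply: (fil_lnc hG); first exact: sg_valP.
  by move=> _ /mapP[v _ ->]; apply: sg_valP.
have piM : {morph (fun u : S => phi (sval u)) : u v / u * v}.
  by move=> u v; apply: (coverM c (S0 u) (S0 v)).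
pose pi : hom S A := mkhom piM.
have lift a : exists u, pi u = a.
  have [g g1 <-] := (coverP c 1 a).1 (conj I I).
  by exists (sg_sub sG g1).
have [f fE] := boolp.choice (fun i => lift (b i)).
have [[psi psiE] _] := freeA S nS f.
have [_ uniqA] := freeA A nA b.
(* Both maps fix every [b i], so [psi] is a section of [pi] and carries an involution of [A] into
   the cover. *)
have psiK : pi \o psi =1 id.
  by apply: (uniqA (pi \o psi) idfun) => i //; apply: etrans (congr1 pi (psiE i)) (fE i).
move=> a _ aa; rewrite -(psiK a).
suff -> : (pi \o psi) a = pi 1 by rewrite gmulf1.
congr (pi _).
apply: sg_val_inj; apply: (cover_inv c); first exact: S0.
by rewrite -[_ * _]/(sval (psi a * psi a)) -gmulfM aa gmulf1.
Qed.

(** * Normal forms in free products *)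

Section Permutations.
Variable T : Type.

Record perms := Perms {
  pfun : T -> T; pinv : T -> T; pfunK : cancel pfun pinv; pinvK : cancel pinv pfun }.
HB.instance Definition _ := gen_eqMixin perms.
HB.instance Definition _ := gen_choiceMixin perms.

Lemma perms_eq (u v : perms) : pfun u =1 pfun v -> u = v.
Proof.
case: u v => [f g fK gK] [f' g' fK' gK'] /= /funext ff'; subst f'.
have gg' : g = g' by apply/funext => x; rewrite -{1}(gK' x) fK.
by subst g'; congr Perms; apply: Prop_irrelevance.
Qed.

Definition perms_mul (u v : perms) : perms :=
  Perms (can_comp (pfunK u) (pfunK v)) (can_comp (pinvK v) (pinvK u)).
Definition perms_one : perms := @Perms id id (fun=> erefl) (fun=> erefl).
Definition perms_inv (u : perms) : perms := Perms (pinvK u) (pfunK u).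

Lemma perms_mulA : associative perms_mul.
Proof. by move=> u v w; apply: perms_eq. Qed.
Lemma perms_mul1 : left_id perms_one perms_mul.
Proof. by move=> u; apply: perms_eq. Qed.
Lemma perms_1mul : right_id perms_one perms_mul.
Proof. by move=> u; apply: perms_eq. Qed.
Lemma perms_mulV : left_inverse perms_one perms_inv perms_mul.
Proof. by move=> u; apply: perms_eq => x; apply: pfunK. Qed.
Lemma perms_Vmul : right_inverse perms_one perms_inv perms_mul.
Proof. by move=> u; apply: perms_eq => x; apply: pinvK. Qed.

HB.instance Definition _ :=
  isGroup.Build perms perms_mulA perms_mul1 perms_1mul perms_mulV perms_Vmul.

End Permutations.

Section NormalForms.
Variables (I : eqType) (A : groupType).
Implicit Types (i j : I) (a b : A) (t u v : I * A) (s : seq (I * A)).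

Local Notation FP := (free_prod (fun _ : I => A)).
Definition inj i a : FP := fp_in (fun _ : I => A) i a.

Lemma injM i a b : inj i (a * b) = inj i a * inj i b.
Proof. exact: gmulfM. Qed.

Lemma inj1 i : inj i 1 = 1.
Proof. exact: gmulf1. Qed.

Lemma injV i a : inj i a^-1 = (inj i a)^-1.
Proof. exact: gmulfV. Qed.

Lemma FP_ind (P : FP -> Prop) :
  P 1 -> (forall i a g, P g -> P (inj i a * g)) -> forall g, P g.
Proof.
move=> P1 PM g; have [w <-] := quo_proj_surj g; elim/fclassW: w.
elim=> [|[[i a] b] w IH].
  by rewrite (_ : fclass [::] = 1) // gmulf1.
rewrite -cat1s fclassM gmulfM; case: b; last exact: PM.
by rewrite fclass_neg gmulfV -[(quo_proj _ _)^-1]injV; apply: PM.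
Qed.

Definition alternating : rel (I * A) := fun t u => t.1 != u.1.

Definition reduced s : bool := all (fun t => t.2 != 1) s && sorted alternating s.

Definition push t s : seq (I * A) :=
  if t.2 == 1 then s else
  if s is u :: s' then
    if t.1 == u.1 then
      if t.2 * u.2 == 1 then s' else (t.1, t.2 * u.2) :: s'
    else t :: s
  else [:: t].

Lemma reduced_cons t s : reduced (t :: s) =
  [&& t.2 != 1, reduced s & if s is u :: _ then t.1 != u.1 else true].
Proof.
rewrite /reduced /=; case: (t.2 != 1) => //=; case: (all _ s) => //=.
by case: s => //= u s; rewrite andbC.
Qed.

Lemma reduced_cat s s' : reduced (s ++ s') -> reduced s /\ reduced s'.
Proof.
elim: s => //= t s IH; rewrite !reduced_cons => /and3P[t1 /IH[rs rs'] ts].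
by split=> //; rewrite t1 rs; case: s ts {IH rs}.
Qed.

Lemma reduced_cat_cons s t s' :
  reduced (rcons s t) -> reduced (t :: s') -> reduced (s ++ t :: s').
Proof.
elim: s => //= u s IH + rts; rewrite !reduced_cons => /and3P[u1 rst us].
by rewrite u1 IH //; case: s us {IH rst}.
Qed.

Lemma reduced_rcons_eq s t a :
  a != 1 -> reduced (rcons s t) -> reduced (rcons s (t.1, a)).
Proof.
move=> a1; elim: s => [_|u s IH] /=; first by rewrite reduced_cons a1.
rewrite !reduced_cons => /and3P[-> /IH -> us] /=.
by case: s us {IH}.
Qed.

Lemma push_reduced t s : reduced s -> reduced (push t s).
Proof.
rewrite /push; case: ifPn => // t1; case: s => [|u s]; first by rewrite reduced_cons t1.
rewrite reduced_cons => /and3P[u1 rs us]; case: eqVneq => [tu|tu].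
  by case: ifPn => // tu1; rewrite reduced_cons tu1 rs /= tu; case: s us {rs}.
by rewrite !reduced_cons t1 u1 rs us.
Qed.

Lemma push1 i s : push (i, 1) s = s.
Proof. by rewrite /push eqxx. Qed.

Lemma push_cons t s : reduced (t :: s) -> push t s = t :: s.
Proof.
rewrite reduced_cons /push => /and3P[/negPf -> _].
by case: s => // u s /negPf ->.
Qed.

(** All comparisons of cancellations are made here; they amount to saying that each factor acts on
    reduced words. *)
Lemma pushM i a b s :
  reduced s -> push (i, a) (push (i, b) s) = push (i, a * b) s.
Proof.
move=> rs; case: (eqVneq a 1) => [->|a1]; first by rewrite push1 mul1g.
case: (eqVneq b 1) => [->|b1]; first by rewrite push1 mulg1.
have [ab|ab] := eqVneq (a * b) 1.
  rewrite ab push1 {2}/push /= (negPf b1); case: s rs => [|[j c] s] rs /=.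
    by rewrite /push /= (negPf a1) eqxx ab eqxx.
  have bE : b = a^-1 by apply: (mulgI a); rewrite ab mulgV.
  move: rs; rewrite reduced_cons /= => /and3P[c1 rs cs].
  case: eqVneq cs => [<- cs|ij cs].
    case: eqVneq => [bc|bc].
      have -> : c = a by apply: (mulgI b); rewrite bc bE mulVg.
      by rewrite push_cons // reduced_cons /= a1 rs.
    by rewrite /push /= (negPf a1) eqxx mulgA ab mul1g (negPf c1).
  by rewrite /push /= (negPf a1) eqxx ab eqxx.
rewrite {2 3}/push /= (negPf b1) (negPf ab).
case: s rs => [|[j c] s] rs /=.
  by rewrite /push /= (negPf a1) eqxx (negPf ab).
move: rs; rewrite reduced_cons /= => /and3P[c1 rs cs].
case: eqVneq cs => [<- cs|ij cs]; last first.
  by rewrite /push /= (negPf a1) eqxx (negPf ab).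
case: (eqVneq (b * c) 1) => [bc|bc].
  rewrite -mulgA bc mulg1 (negPf a1) push_cons //.
  by rewrite reduced_cons /= a1 rs.
by rewrite /push /= (negPf a1) eqxx mulgA.
Qed.

Definition rword := {s : seq (I * A) | reduced s}.

Definition rpush i a (w : rword) : rword :=
  exist _ (push (i, a) (sval w)) (push_reduced (i, a) (svalP w)).

Lemma rpushM i a b w : rpush i a (rpush i b w) = rpush i (a * b) w.
Proof. by apply: val_inj; apply: pushM; apply: (svalP w). Qed.

Lemma rpush1 i w : rpush i 1 w = w.
Proof. by apply: val_inj; apply: push1. Qed.

Lemma rpushK i a : cancel (rpush i a) (rpush i a^-1).
Proof. by move=> w; rewrite rpushM mulVg rpush1. Qed.

Lemma rpushVK i a : cancel (rpush i a^-1) (rpush i a).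
Proof. by move=> w; rewrite rpushM mulgV rpush1. Qed.

Definition rperm i a : perms rword := Perms (rpushK i a) (rpushVK i a).

Lemma rpermM i : {morph rperm i : a b / a * b}.
Proof. by move=> a b; apply: perms_eq => w; rewrite /= rpushM. Qed.

(** Van der Waerden's method: the free product acts on reduced words, and the image of the empty
    word under [g] is the normal form of [g]. *)
Definition rword_act : hom FP (perms rword) :=
  fp_lift (fun i => mkhom (rpermM i)).

Definition nf (g : FP) : seq (I * A) := sval (pfun (rword_act g) (exist _ [::] isT)).

Lemma nf_reduced g : reduced (nf g).
Proof. exact: (svalP (pfun (rword_act g) _)). Qed.

Lemma nf1 : nf 1 = [::].
Proof. by rewrite /nf gmulf1. Qed.

Lemma nf_injM i a g : nf (inj i a * g) = push (i, a) (nf g).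
Proof. by rewrite /nf gmulfM [rword_act (inj i a)](fp_lift_in (fun i => mkhom (rpermM i))). Qed.

Definition wprod s : FP := \prod_(t <- s) inj t.1 t.2.

Lemma wprod_nil : wprod [::] = 1.
Proof. exact: big_nil. Qed.

Lemma wprod_cons t s : wprod (t :: s) = inj t.1 t.2 * wprod s.
Proof. exact: big_cons. Qed.

Lemma wprod_cat s s' : wprod (s ++ s') = wprod s * wprod s'.
Proof. exact: big_cat. Qed.

Lemma wprod_rcons s t : wprod (rcons s t) = wprod s * inj t.1 t.2.
Proof. by rewrite -cats1 wprod_cat wprod_cons wprod_nil mulg1. Qed.

Lemma wprod_push t s : wprod (push t s) = inj t.1 t.2 * wprod s.
Proof.
rewrite /push; case: eqVneq => [->|_]; first by rewrite inj1 mul1g.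
case: s => [|u s]; first by rewrite wprod_cons.
rewrite wprod_cons; case: eqVneq => [->|_]; last by rewrite !wprod_cons.
rewrite mulgA -injM; case: eqVneq => [->|_]; last by rewrite wprod_cons.
by rewrite inj1 mul1g.
Qed.

Lemma nfK g : wprod (nf g) = g.
Proof.
elim/FP_ind: g => [|i a g IH]; first by rewrite nf1 wprod_nil.
by rewrite nf_injM wprod_push IH.
Qed.

Lemma nf_wprod s : reduced s -> nf (wprod s) = s.
Proof.
elim: s => [|[i a] s IH] rs; first by rewrite wprod_nil nf1.
have [_ rs'] := @reduced_cat [:: (i, a)] s rs.
by rewrite wprod_cons nf_injM IH // push_cons.
Qed.

Lemma size_push t s : (size (push t s) <= (size s).+1)%N.
Proof. by rewrite /push; case: ifP => // _; case: s => //= u s; do 2?case: ifP => //=; lia. Qed.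

Lemma size_nf_wprod s : (size (nf (wprod s)) <= size s)%N.
Proof.
elim: s => [|[i a] s IH]; first by rewrite wprod_nil nf1.
by rewrite wprod_cons nf_injM (leq_trans (size_push _ _)).
Qed.

Lemma nf_inj i a : a != 1 -> nf (inj i a) = [:: (i, a)].
Proof. by move=> a1; rewrite -[inj i a]mulg1 nf_injM nf1 /push /= (negPf a1). Qed.

Lemma inj_eq1 i a : inj i a = 1 -> a = 1.
Proof. by case: (eqVneq a 1) => // a1 e; have := nf_inj i a1; rewrite e nf1. Qed.

Lemma nf_nil g : nf g = [::] -> g = 1.
Proof. by move=> e; rewrite -(nfK g) e wprod_nil. Qed.

(** Each letter of [g] disturbs only the front of the word, so a prefix with as many letters as an
    expression of [g] shields the tail. The length bound keeps the prefix from being exhausted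
    during the induction. *)
Lemma nf_mul_long g : exists N, forall s s', reduced (s ++ s') -> (N <= size s)%N ->
  nf (g * wprod (s ++ s')) = nf (g * wprod s) ++ s' /\
  (size s <= size (nf (g * wprod s)) + N)%N.
Proof.
elim/FP_ind: g => [|i a g [N IH]].
  exists 0%N => s s' rs _; have [rs1 _] := reduced_cat rs.
  by rewrite !mul1g !nf_wprod // addn0.
exists N.+1 => s s' rs Ns; have [|e le] := IH s s' rs; first exact: ltnW.
rewrite -!mulgA !nf_injM e.
case: (nf (g * wprod s)) le => [|u w] /= le; first by lia.
rewrite /push /=; case: ifP => _ /=; first by split=> //; lia.
case: ifP => _ /=; last by split=> //; lia.
by case: ifP => _ /=; split=> //; lia.
Qed.

(** The last letter of [p] meets the first letter of [nf g]: they stay apart, merge, or cancel. Only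
    cancellation continues, and it uses up a letter of [nf g] each time. *)
Lemma nf_mul_prefix p g : reduced p -> exists m q,
  (size p <= m + size (nf g))%N /\ nf (wprod p * g) = take m p ++ q.
Proof.
elim/last_ind: p g => [|p t IH] g rp.
  by exists 0%N, (nf (wprod [::] * g)).
have [rp' _] : reduced p /\ reduced [:: t] by apply: reduced_cat; rewrite cats1.
have t1 : t.2 != 1.
  by move: rp; rewrite /reduced all_rcons => /andP[/andP[]].
have := nfK g; have := nf_reduced g; case: (nf g) => [|u w] rw gE.
  exists (size (rcons p t)), [::]; split; first by lia.
  by rewrite take_size cats0 -gE wprod_nil mulg1 nf_wprod.
have [ru rw'] := @reduced_cat [:: u] w rw.
have [tu|tu] := eqVneq t.1 u.1; last first.
  exists (size (rcons p t)), (u :: w); split; first by lia.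
  rewrite take_size -gE -wprod_cat nf_wprod // cat_rcons.
  by apply: reduced_cat_cons => //; rewrite reduced_cons t1 rw.
have gtE : wprod (rcons p t) * g = wprod p * (inj t.1 (t.2 * u.2) * wprod w).
  by rewrite -gE wprod_rcons wprod_cons injM tu !mulgA.
rewrite gtE; have [tu1|tu1] := eqVneq (t.2 * u.2) 1.
  rewrite tu1 inj1 mul1g; have [m [q [mq e]]] := IH (wprod w) rp'.
  rewrite nf_wprod // in mq; exists (minn m (size p)), q.
  rewrite size_rcons /=; split; first by lia.
  rewrite e -cats1 takel_cat ?geq_minr //.
  by congr (_ ++ _); case: (leqP m (size p)) => // /ltnW ?; rewrite take_size take_oversize.
exists (size p), ((t.1, t.2 * u.2) :: w); rewrite size_rcons /=; split; first by lia.
rewrite -cats1 take_size_cat // -(wprod_cons (t.1, t.2 * u.2)) -wprod_cat nf_wprod //.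
apply: reduced_cat_cons; first exact: reduced_rcons_eq.
by move: rw; rewrite !reduced_cons tu1 tu => /and3P[_ -> ->].
Qed.

End NormalForms.

(** * Conjugation in free products *)

(** Starting from [h], take commutators with elements of [H] as long as they are nontrivial. The
    identity stops this within [k] steps, and the last one is central. *)
Lemma nilpotent_central k (G : groupType) (H : set G) h :
  nilpotent_subgroup k H -> H h -> h != 1 ->
  exists z, [/\ H z, z != 1 & forall y, H y -> z * y = y * z].
Proof.
move=> [[_ HM HV] nH] Hh h1.
have {nH} : forall s, size s = k -> (forall y, y \in s -> H y) -> left_normed_comm h s = 1.
  by move=> s sk sH; apply: nH.
elim: k => [|k IH] in h Hh h1 *; first by move=> /(_ [::] erefl)/= h0; rewrite h0 ?eqxx in h1.
move=> hs; case: (pselect (forall y, H y -> h * y = y * h)) => [hc|].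
  by exists h.
move=> /existsNP[y /not_implyP[Hy hy]].
have Hhy : H [~ h, y] by apply: (HM); [apply: HV|apply: (HM); [apply: HV|apply: HM]].
apply: (IH [~ h, y]) => //; first by apply/negP => /commgP.
move=> s sk sH; apply: (hs (y :: s)); first by rewrite /= sk.
by move=> z; rewrite in_cons => /predU1P[->|/sH].
Qed.

Lemma lnc1 (G : groupType) (s : seq G) : left_normed_comm 1 s = 1.
Proof. by elim: s => //= y s IH; rewrite comm1g. Qed.

Lemma nilpotent_preim k (G H : groupType) (f : hom G H) (M : set H) :
  injective f -> nilpotent_subgroup k M -> nilpotent_subgroup k [set x | M (f x)].
Proof.
move=> fI [[M1 MM MV] nM]; split.
  split=> /= [|x y hx hy|x hx]; rewrite ?gmulf1 ?gmulfM ?gmulfV //.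
    exact: MM.
  exact: MV.
move=> x s sk Mx Ms; apply: fI; rewrite gmulf1 hom_lnc; apply: nM => //.
  by rewrite size_map.
by move=> _ /mapP[y ys ->]; apply: Ms.
Qed.

Lemma nilpotent_image k (G H : groupType) (f : hom G H) (M : set G) :
  nilpotent_subgroup k M -> nilpotent_subgroup k (f @` M).
Proof.
move=> [[M1 MM MV] nM]; split.
  split=> [|_ _ [x Mx <-] [y My <-]|_ [x Mx <-]].
  - by exists 1; rewrite ?gmulf1.
  - by exists (x * y); [apply: MM|rewrite gmulfM].
  - by exists x^-1; [apply: MV|rewrite gmulfV].
move=> _ s sk [x Mx <-] Ms.
have [s' sE Ms'] : exists2 s', s = map f s' & forall y, y \in s' -> M y.
  elim: s Ms {sk} => [|y0 s IH] Ms; first by exists [::].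
  have [s' -> Ms'] := IH (fun y ys => Ms y (mem_behead (s := y0 :: s) ys)).
  have [y My <-] := Ms y0 (mem_head _ _); exists (y :: s') => // z.
  by rewrite in_cons => /predU1P[->|/Ms'].
rewrite sE size_map in sk.
by rewrite sE -hom_lnc nM // gmulf1.
Qed.

(* The form in which conjugate separation passes to discriminated groups. *)
Definition nilpotent_absorbing (k : nat) (G : groupType) : Prop :=
  forall (H : set G) h x, nilpotent_subgroup k H -> H h -> h != 1 -> H (h ^ x) ->
    exists M, [/\ nilpotent_subgroup k M, H `<=` M & M x].

Section Rays.
Variables (I : eqType) (A : groupType).
Local Notation FP := (free_prod (fun _ : I => A)).
Implicit Types (g h x y z : FP).

(** A first letter of [x] in factor [i] is absorbed into [a], which shortens [x]. Otherwise
    [inj i a * x] starts in factor [i], whereas [x * inj i b] keeps the first letter of [x] unless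
    [x] is a single letter; that case is compared directly. *)
Lemma factor_malnormal i (a : A) x : a != 1 ->
  range (inj i) (inj i a ^ x) -> range (@inj I A i) x.
Proof.
have [n] := ubnP (size (nf x)); elim: n => // n IH in a x *.
move=> xn a1 [b _ /esym ab]; have := nfK x; have := nf_reduced x.
case E : (nf x) xn => [|[j c] s] //= xn rs xE.
  by exists 1; rewrite // inj1 -xE wprod_nil.
have [_ rs'] := @reduced_cat _ _ [:: (j, c)] s rs.
have [ij|ij] := eqVneq i j.
  subst j; rewrite wprod_cons /= in xE.
  have [|||d _ sE] := IH (a ^ c) (wprod s).
  - by rewrite nf_wprod //; lia.
  - by rewrite conjg_eq1.
  - exists b => //; rewrite -ab -xE conjgM; congr (_ ^ _).
    by rewrite /conjg !injM injV.
  by exists (c * d); rewrite // -xE -sE injM.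
have b1 : b != 1.
  apply/eqP => b1; move: ab; rewrite b1 inj1 => /eqP; rewrite conjg_eq1.
  by move=> /eqP /inj_eq1 /eqP; rewrite (negPf a1).
have xb : inj i a * x = x * inj i b by rewrite -ab /conjg mulVKg.
have := congr1 (@nf _ _) xb; rewrite nf_injM E push_cons; last first.
  by rewrite reduced_cons /= a1 rs.
have rx : reduced (nf x) := nf_reduced x.
have [m [q [mq e]]] := nf_mul_prefix (inj i b) rx.
rewrite nfK E nf_inj //= in mq e; rewrite e.
case: m {e} mq => [|m] mq; last by move=> [/eqP]; rewrite (negPf ij).
have s0 : s = [::] by case: s {rs E xn xE rs' q} mq => //=.
move=> _; have xE' : x = inj j c by rewrite -xE s0 wprod_cons wprod_nil mulg1.
have : wprod [:: (i, a); (j, c)] = wprod [:: (j, c); (i, b)].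
  by rewrite !wprod_cons !wprod_nil !mulg1 /= -xE' xb.
move: rs; rewrite s0 reduced_cons /= => /andP[c1 _].
move=> /(congr1 (@nf _ _)); rewrite !nf_wprod ?reduced_cons /= ?a1 ?c1 ?b1 ?ij //=.
  by move=> [/eqP]; rewrite (negPf ij).
by rewrite eq_sym ij.
Qed.

(** * Infinite reduced words, regarded as ends, and their stabilisers *)

Definition ray (xi : nat -> I * A) : Prop :=
  forall n, (xi n).2 != 1 /\ (xi n).1 != (xi n.+1).1.

Section Ray.
Variable xi : nat -> I * A.
Hypothesis rxi : ray xi.

Definition initial (n : nat) : FP := wprod (mkseq xi n).

Lemma initial_reduced n : reduced (mkseq xi n).
Proof.
apply/andP; split.
  by apply/allP => _ /mapP[i _ ->]; case: (rxi i).
rewrite /mkseq; move: 0%N; elim: n => // n IH i; have := IH i.+1.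
by case: n {IH} => //= n ->; rewrite andbT; case: (rxi i).
Qed.

Lemma nf_initial n : nf (initial n) = mkseq xi n.
Proof. by rewrite nf_wprod ?initial_reduced. Qed.

Lemma initial_inj : injective initial.
Proof.
by move=> n n' /(congr1 (@nf _ _)) /(congr1 size); rewrite !nf_initial !size_mkseq.
Qed.

(** The element fixes the end [xi] and translates along it by [b - a]. Two naturals record both this
    integer and how far out the translation begins. *)
Definition shifts (a b : nat) x : Prop :=
  forall n, x * initial (a + n) = initial (b + n).

Definition ray_stab : set FP := [set x | exists a b, shifts a b x].

Lemma shifts1 : shifts 0 0 1.
Proof. by move=> n; rewrite mul1g. Qed.

Lemma shiftsM a b c d x y :
  shifts a b x -> shifts c d y -> shifts (a + c) (b + d) (x * y).
Proof.
move=> hx hy n; rewrite -mulgA [(a + c)%N]addnC -addnA hy addnCA hx.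
by rewrite addnA.
Qed.

Lemma shiftsV a b x : shifts a b x -> shifts b a x^-1.
Proof. by move=> hx n; rewrite -hx mulKg. Qed.

Lemma shiftsX a b x n : shifts a b x -> shifts (n * a) (n * b) (x ^+ n).
Proof.
move=> hx; elim: n => [|n IH]; first exact: shifts1.
by rewrite expgS !mulSn; apply: shiftsM.
Qed.

(** Both elements send the prefix of length [a + c] to the same prefix. With [shifts_diff], this
    embeds the stabiliser in [Z] by translation length. *)
Lemma shifts_eq a b c d x y :
  shifts a b x -> shifts c d y -> (a + d = b + c)%N -> x = y.
Proof.
move=> hx hy e; have := hx c; rewrite addnC => hxc; have := hy a.
by rewrite [(d + a)%N]addnC e -hxc => /mulIg.
Qed.

Lemma shifts_diff a b c d x :
  shifts a b x -> shifts c d x -> (a + d = b + c)%N.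
Proof.
move=> hx hy; apply: initial_inj.
by rewrite [(a + d)%N]addnC -hy addnC hx.
Qed.

Lemma ray_stab_subgroup : is_subgroup ray_stab.
Proof.
split=> [|x y [a [b hx]] [c [d hy]]|x [a [b hx]]].
- by exists 0%N, 0%N; apply: shifts1.
- by exists (a + c)%N, (b + d)%N; apply: shiftsM.
- by exists b, a; apply: shiftsV.
Qed.

Lemma ray_stab_comm x y : ray_stab x -> ray_stab y -> x * y = y * x.
Proof.
move=> [a [b hx]] [c [d hy]]; apply: shifts_eq (shiftsM hx hy) (shiftsM hy hx) _.
lia.
Qed.

(* [x * initial n] ends like [initial n] for large [n]; for [n] in a suitable
   arithmetic progression it is [h ^+ j * g] with [g] fixed, which begins like
   the ray up to boundedly many letters. *)
Lemma shifts_conj a b a' b' h h' x : shifts a b h -> shifts a' b' h' ->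
  (a < b)%N -> (a' < b')%N -> h * x = x * h' -> ray_stab x.
Proof.
move=> hh hh' ab ab' hx.
have [N hN] := nf_mul_long x; pose u := nf (x * initial N).
have iter_shift c d y j : shifts c d y -> (c < d)%N ->
    y ^+ j * initial c = initial (c + j * (d - c)).
  move=> hy cd; elim: j => [|j IH]; first by rewrite mul1g addn0.
  rewrite expgS -mulgA IH hy; congr initial; lia.
have xj j : h ^+ j * x = x * h' ^+ j.
  elim: j => [|j IH]; first by rewrite mul1g mulg1.
  by rewrite !expgS -mulgA IH mulgA hx !mulgA.
have xN n : nf (x * initial (N + n)) = u ++ map xi (iota N n).
  have e : mkseq xi (N + n) = mkseq xi N ++ map xi (iota N n).
    by rewrite /mkseq iotaD map_cat.
  rewrite /initial e; have [||-> _] // := hN (mkseq xi N) (map xi (iota N n)).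
  - by rewrite -e initial_reduced.
  - by rewrite size_mkseq.
suff xT n : u ++ map xi (iota N n) = mkseq xi (size u + n).
  exists N, (size u) => n; rewrite -[LHS]nfK xN xT //.
pose g := (initial a)^-1 * x * initial a'; pose L := size (nf g).
(* Large enough that the power of [h'] reaches past [N + n] letters, and that losing [L] letters to
   [g] leaves [size u + n] letters of the ray. *)
pose j := (N + n + size u + L)%N.
have [m [q [mq e]]] := nf_mul_prefix g (initial_reduced (a + j * (b - a))).
have n'E : exists n', (a' + j * (b' - a') = N + n + n')%N.
  exists (a' + j * (b' - a') - N - n)%N; nia.
case: n'E => n' n'E.
have : nf (x * initial (N + n + n')) = take m (mkseq xi (a + j * (b - a))) ++ q.
  rewrite -e -n'E -(iter_shift _ _ _ _ hh' ab') mulgA -xj; congr nf.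
  by rewrite -[wprod _]/(initial _) -(iter_shift _ _ _ _ hh ab) /g !mulgA mulgK.
rewrite -addnA xN iotaD map_cat catA => /(congr1 (take (size u + n))).
rewrite take_size_cat; last by rewrite size_cat size_map size_iota.
move=> ->; rewrite size_mkseq in mq.
have mL : (size u + n <= m)%N by rewrite /j in mq; nia.
have jL : (size u + n <= a + j * (b - a))%N by rewrite /j; nia.
rewrite takel_cat; last by rewrite size_take size_mkseq; case: ifP; lia.
by rewrite take_takel // /mkseq -map_take take_iota; congr (map _ (iota _ _)); lia.
Qed.

End Ray.

Definition in_factor x : Prop := exists i a, x = inj i a.

(** Offset 0 forces [x] to be the prefix of length [n] and [xi] to be its periodic repetition, the
    attracting end of [x]. *)
Definition hyperbolic x : Prop :=
  exists2 xi, ray xi & exists2 n, (0 < n)%N & shifts xi 0 n x.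

(** If the first and last letters share a factor, conjugating by the first merges them and shortens
    the word. If not, powers of the word do not cancel, and its periodic repetition is a ray. *)
Lemma cyclic_reduction z : z != 1 -> exists g, in_factor (z ^ g) \/ hyperbolic (z ^ g).
Proof.
have [n] := ubnP (size (nf z)); elim: n => // n IH in z *.
move=> zn z1; have := nfK z; have := nf_reduced z.
case E : (nf z) zn => [|t s] zn rs zE; first by rewrite (nf_nil E) eqxx in z1.
elim/last_ind: s => [|s u _] in rs zE zn E *.
  exists 1; left; exists t.1, t.2.
  by rewrite conjg1 -zE wprod_cons wprod_nil mulg1.
have [tu|tu] := eqVneq t.1 u.1.
  have zt : z ^ inj t.1 t.2 = wprod (rcons s (u.1, u.2 * t.2)).
    rewrite -zE wprod_cons !wprod_rcons /= injM tu /conjg !mulgA.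
    by rewrite mulVg mul1g.
  have [||g hg] := IH (z ^ inj t.1 t.2).
  - have := size_nf_wprod (rcons s (u.1, u.2 * t.2)).
    by rewrite zt size_rcons; rewrite /= size_rcons in zn; lia.
  - by rewrite conjg_eq1.
  by exists (inj t.1 t.2 * g); rewrite conjgM.
exists 1; right; rewrite conjg1.
set w := t :: rcons s u in rs zE E *.
have w0 : (0 < size w)%N by [].
pose xi m := nth t w (m %% size w).
have xiS m : xi (size w + m)%N = xi m by rewrite /xi modnDl.
have pre m : mkseq xi (size w + m) = w ++ mkseq xi m.
  rewrite /mkseq iotaD map_cat; congr (_ ++ _).
    apply: (@eq_from_nth _ t); first by rewrite size_map size_iota.
    move=> i; rewrite size_map size_iota => iw.
    by rewrite (nth_map 0%N) ?size_iota // nth_iota // add0n /xi modn_small.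
  rewrite -[(0 + size w)%N]addn0 [(0 + _)%N]add0n iotaDl -map_comp.
  by apply: eq_map => i /=.
exists xi; last by exists (size w) => // m; rewrite add0n /initial pre wprod_cat zE.
move=> m; have wm := ltn_pmod m w0; move: rs => /andP[/allP w1 ws].
split; first by apply: w1; apply: mem_nth.
have := divn_eq m (size w); set q := (m %/ _)%N; set r := (m %% _)%N => mE.
have xE l : xi (q * size w + l)%N = xi l by rewrite /xi modnMDl.
rewrite mE -addnS !xE; case: (ltnP r.+1 (size w)) => rw.
  rewrite {1}/xi (modn_small wm) /xi (modn_small rw).
  by move/(sortedP t): ws; apply.
have rE : r = size (rcons s u).
  by apply/eqP; rewrite eqn_leq -ltnS -[X in _ && X]ltnS; apply/andP.
have -> : xi r.+1 = t by rewrite /xi rE modnn.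
have -> : xi r = u.
  rewrite /xi (modn_small wm) -/r rE /w -rcons_cons nth_rcons /= size_rcons.
  by rewrite ltnn eqxx.
by rewrite eq_sym.
Qed.

(** An involution conjugate into a factor gives one in [A]; a hyperbolic element has a square that
    translates by [n + n], which is not 0. *)
Lemma free_prod_no_involution : no_involution [set: A] -> no_involution [set: FP].
Proof.
move=> nA x _ xx; apply/eqP; apply/negP => /negP x1.
have [g [[i [a xE]]|[xi rxi [n n0 xn]]]] := cyclic_reduction x1.
  have aa : a * a = 1.
    by apply: (@inj_eq1 _ _ i); rewrite injM -xE -conjMg xx conj1g.
  by move: x1; rewrite -(conjg_eq1 x g) xE (nA a) // inj1 eqxx.
have := shiftsM xn xn; rewrite -conjMg xx conj1g => /(shifts_diff rxi).
by move=> /(_ _ _ (shifts1 xi)); lia.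
Qed.

(* [x] conjugates [h ^+ d] to [h ^- d'], so [x * x] preserves the direction. *)
Lemma shifts_flip xi a b a' b' h x : no_involution [set: A] -> ray xi ->
  shifts xi a b h -> shifts xi a' b' (h ^ x) -> (a < b)%N -> (b' < a')%N -> False.
Proof.
move=> nA rxi hh hh' ab ab'.
have commF : h ^ x <> h.
  by move=> e; rewrite e in hh'; have := shifts_diff rxi hh hh'; lia.
have stabF : ~ ray_stab xi x.
  move=> sx; have sh : ray_stab xi h by exists a, b.
  by apply: commF; rewrite /conjg (ray_stab_comm sh sx) mulKg.
(* As [h] translates by [d] and [h ^ x] by [- d'], both [(h ^+ d) ^ x] and [(h ^+ d')^-1] translate
   by [- d * d'], hence coincide. *)
pose d := (b - a)%N; pose d' := (a' - b')%N.
have hd : (h ^+ d) ^ x = (h ^+ d')^-1.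
  rewrite conjXg; apply: shifts_eq (shiftsX d hh') (shiftsV (shiftsX d' hh)) _.
  rewrite /d /d'; nia.
have hdd : (h ^+ (d * d)) ^ (x * x) = h ^+ (d' * d').
  rewrite conjgM !expgnA conjXg hd expVgn conjVg expgnAC.
  by rewrite conjXg hd expVgn invgK.
have sxx : ray_stab xi (x * x).
  apply: (shifts_conj rxi (shiftsX (d * d) hh) (shiftsX (d' * d') hh)).
  - rewrite /d; nia.
  - rewrite /d'; nia.
  - by rewrite -hdd /conjg mulVKg.
(* If [x * x] translates nontrivially, [x] commutes with it and so fixes the end; if not, [x * x] is
   1. *)
have [c [e hc]] := sxx; case: (ltngtP c e) => ce.
- apply: stabF; apply: (shifts_conj rxi hc hc ce ce); by rewrite mulgA.
- apply: stabF; apply: (shifts_conj rxi (shiftsV hc) (shiftsV hc) ce ce).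
  by rewrite invgM; group_word.
- have x1 : x = 1.
    apply: (free_prod_no_involution nA) => //.
    by apply: shifts_eq hc (@shifts1 xi) _; rewrite ce.
  by apply: commF; rewrite x1 conjg1.
Qed.

Lemma free_prod_absorbing k : (0 < k)%N -> nilpotent_group k A ->
  no_involution [set: A] -> nilpotent_absorbing k FP.
Proof.
move=> k0 nA iA H h x nH Hh h1 Hhx.
have [z [Hz z1 zc]] := nilpotent_central nH Hh h1.
have [g zg] := cyclic_reduction z1.
pose pre (M : set FP) : set FP := [set y | M (y ^ g)].
suff [M [nM HM Mx]] : exists M, [/\ nilpotent_subgroup k M, H `<=` pre M & M (x ^ g)].
  exists (pre M); split=> //.
  apply: (nilpotent_preim (f := mkhom (fun u v => conjMg u v g))) nM.
  exact: conjg_inj.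
have zcg y : H y -> z ^ g * y ^ g = y ^ g * z ^ g by move=> /zc; rewrite -!conjMg => ->.
have hg1 : h ^ g != 1 by rewrite conjg_eq1.
have hxg : (h ^ g) ^ (x ^ g) = (h ^ x) ^ g by rewrite -conjJg.
case: zg => [[i [a za]]|[xi rxi [n n0 zn]]].
  exists (range (@inj I A i)).
  have a1 : a != 1 by apply/eqP => a1; move: z1; rewrite -(conjg_eq1 z g) za a1 inj1 eqxx.
  have HM : H `<=` pre (range (@inj I A i)).
    move=> y Hy; apply: (factor_malnormal a1); exists a => //.
    by rewrite -za; apply: (mulgI (y ^ g)); rewrite -conjgC zcg.
  split=> //.
    by apply: (nilpotent_image (fp_in (fun _ : I => A) i)).
  have [b _ hb] := HM h Hh; have [c _ hc] := HM _ Hhx.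
  apply: (@factor_malnormal i b).
    by apply: contraNneq hg1 => b1; rewrite -hb b1 inj1.
  by exists c; rewrite // hb hxg.
have HM : H `<=` pre (ray_stab xi).
  move=> y /zcg zy; exact: (shifts_conj rxi zn zn n0 n0 zy).
exists (ray_stab xi); split=> //.
  split; first exact: ray_stab_subgroup.
  move=> y [|u s] sk My Ms; first by rewrite -sk in k0.
  rewrite [LHS]/(left_normed_comm [~ y, u] s).
  have /commgP/eqP -> : commute y u by apply: (ray_stab_comm My); apply: Ms; rewrite mem_head.
  exact: lnc1.
have [a [b hab]] := HM h Hh; have [a' [b' hab']] := HM _ Hhx; rewrite -hxg in hab'.
have hx : h ^ g * x ^ g = x ^ g * (h ^ g) ^ (x ^ g) := conjgC _ _.
have hVx : (h ^ g)^-1 * x ^ g = x ^ g * ((h ^ g) ^ (x ^ g))^-1.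
  by rewrite -[in RHS]conjVg -conjgC.
have ab : a != b.
  apply: contraNneq hg1 => ab; apply/eqP.
  by apply: (shifts_eq hab (@shifts1 xi)); rewrite ab.
have ab' : a' != b'.
  apply: contraNneq hg1 => ab'; rewrite -(conjg_eq1 _ (x ^ g)); apply/eqP.
  by apply: (shifts_eq hab' (@shifts1 xi)); rewrite ab'.
have hV : shifts xi b' a' ((h ^ g)^-1 ^ (x ^ g)) by rewrite conjVg; apply: shiftsV.
(* After inverting [h] if necessary, it translates forward. If [h ^ x] then does too, [x] fixes the
   end; the opposite direction is excluded by [shifts_flip]. *)
case: (ltngtP a b) ab => // ab _; case: (ltngtP a' b') ab' => // ab' _.
- exact: (shifts_conj rxi hab hab' ab ab' hx).
- by have := shifts_flip iA rxi hab hab' ab ab'.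
- by have := shifts_flip iA rxi (shiftsV hab) hV ab ab'.
- exact: (shifts_conj rxi (shiftsV hab) (shiftsV hab') ab ab' hVx).
Qed.

End Rays.

(** * Discrimination *)

Definition discriminated (G F : groupType) : Prop :=
  forall x y : G, x <> 1 -> y <> 1 -> exists f : hom G F, f x <> 1 /\ f y <> 1.

(** By maximality it suffices that [H] and [x] generate a nilpotent subgroup. A nontrivial
    commutator violating this would survive together with [h] in [F], where absorption kills it. *)
Lemma discriminated_CSN k (G F : groupType) :
  nilpotent_absorbing k F -> discriminated G F -> CSN k G.
Proof.
move=> absF disG H [nH maxH] x nHx.
have [[H1 _ _] _] := nH.
apply/seteqP; split=> [h [Hh [h0 Hh0 h0x]]|_ ->]; last first.
  by split=> //; exists 1; rewrite ?conj1g.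
apply: contrapT => h1; apply: nHx.
pose K := generated (H `|` [set x]).
have HK : H `<=` K by move=> y Hy; apply: sub_generated; left.
suff nK : nilpotent_subgroup k K.
  by rewrite -(maxH K nK HK); apply: sub_generated; right.
split=> [|u s sk Ku Ks]; first exact: generated_subgroup.
apply: contrapT => c1; have [f [fh fc]] := disG _ _ h1 c1.
have fhE : f h0 ^ f x = f h by rewrite -gmulfJ h0x.
have [||||M [[sM nM] HM Mx]] := absF (f @` H) (f h0) (f x).
- exact: nilpotent_image.
- by exists h0.
- by apply/eqP => fh0; apply: fh; rewrite -fhE fh0 conj1g.
- by exists h => //; rewrite fhE.
have KM y : K y -> M (f y).
  move=> Ky; apply: (Ky [set y | M (f y)]) => [|z [Hz|->]] //=; last first.
    by apply: HM; exists z.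
  have [M1 MM MV] := sM.
  split=> /= [|v w Mv Mw|v Mv]; rewrite ?gmulf1 ?gmulfM ?gmulfV //.
    exact: MM.
  exact: MV.
apply: fc; rewrite hom_lnc; apply: nM; rewrite ?size_map //; first exact: KM.
by move=> _ /mapP[y ys ->]; apply: KM; apply: Ks.
Qed.

Lemma absorbing_isomorphic k (G F : groupType) :
  isomorphic G F -> nilpotent_absorbing k G -> nilpotent_absorbing k F.
Proof.
move=> [f [g fK gK]] absG H h x nH Hh h1 Hhx.
pose g' : hom F G := mkhom (can2_gmulfM fK gK).
have [||||M [nM HM Mx]] := absG [set y | H (f y)] (g h) (g x).
- by apply: nilpotent_preim => //; apply: can_inj fK.
- by rewrite /= gK.
- by rewrite -[g h]/(g' h) gmulf_eq1 //; apply: can_inj gK.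
- by rewrite /= gmulfJ !gK.
exists [set y | M (g' y)]; split=> //.
  by apply: nilpotent_preim => //; apply: can_inj gK.
by move=> y Hy; apply: HM; rewrite /= gK.
Qed.

Section Coordinate.
Variables (F : groupType) (n : nat) (Y : set (affine F n)).
Implicit Types (S : set (gword F n)) (w : gword F n).

Lemma zero_locus_closed S : zariski_closed (zero_locus S).
Proof.
exists [set zero_locus S]; split=> [_ ->|]; last by rewrite bigcap_set1.
by exists [:: S]; rewrite big_seq1.
Qed.

(** If [w] and [v] were never both nontrivial at a point of [Y], then [Y] would be the union of the
    closed subsets where one of them vanishes; both are proper because neither word lies in the
    radical. *)
Lemma irreducible_discriminated :
  irreducible_algebraic_set Y -> discriminated (coordinate_group Y) F.
Proof.
move=> [[S YE] _ irrY] a b.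
have [w <-] := quo_proj_surj a; have [v <-] := quo_proj_surj b => w1 v1.
suff [p [Yp pw pv]] : exists p, [/\ Y p, gword_eval p w <> 1 & gword_eval p v <> 1].
  have YN u : Rad Y u -> gword_eval p u = 1 by apply.
  by exists (quo_lift YN); rewrite !quo_liftE.
apply: contrapT => noP; apply: irrY.
pose C u := zero_locus (S `|` [set u]).
have CY u : quo_proj (Rad Y) u <> 1 -> C u `<` Y.
  move=> u1; split=> [p Cp|YC].
    by rewrite YE => r Sr; apply: Cp; left.
  by apply: u1; apply/quo_proj_ker => p /YC; apply; right.
exists (C w), (C v); split; try exact: zero_locus_closed; try exact: CY.
apply/seteqP; split=> [p Yp|p [Cp|Cp]].
2: by have [CwY _] := CY w w1; apply: CwY.
2: by have [CvY _] := CY v v1; apply: CvY.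
have Sp r : S r -> gword_eval p r = 1 by move: Yp; rewrite YE; apply.
case: (pselect (gword_eval p w = 1)) => pw.
  by left=> r [/Sp//|->].
case: (pselect (gword_eval p v = 1)) => pv.
  by right=> r [/Sp//|->].
by case: noP; exists p.
Qed.

End Coordinate.

Theorem corollary1 (k : nat) (hk : (0 < k)%N)
    (A : groupType) (hAfg : finitely_generated A) (hA : free_nilpotent k A)
    (F : groupType) (hF : A_free A F)
    (n : nat) (hn : (0 < n)%N)
    (Y : set (affine F n)) (hY : irreducible_algebraic_set Y) :
  CSN k (coordinate_group Y).
Proof.
have nA : nilpotent_group k A by case: hA => [B [b []]].
have iA := free_nilpotent_no_involution hAfg hA.
have [I isoF] := hF.
apply: discriminated_CSN (irreducible_discriminated hY).
apply: absorbing_isomorphic isoF _.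
(* Normal forms compare indices, so the index type is given classical decidable equality. *)
exact: (@free_prod_absorbing {classic I} A k hk nA iA).
Qed.
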